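(* Let $k\ge2$, $0<a<1$, $d\ge2$, and let $\{\eta_n\}_{n\ge0}\subset\mathbb{C}\setminus\{0\}$ satisfy $|\eta_n|\le a^{d^n}$ for all $n\ge0$. Let \[ F_n(z_1,\dots,z_k)=(\eta_n z_k,\ z_2^d+\eta_n z_1,\ z_3^d+\eta_n z_2,\ \dots,\ z_k^d+\eta_n z_{k-1}), \] $F(n)=F_n\circ\cdots\circ F_0$, and $\Omega_{\{F_n\}}=\{z\in\mathbb{C}^k: F(n)(z)\to0 \text{ as } n\to\infty\}$. Then: (i) $\Omega_{\{F_n\}}$ is a non-empty open connected set; (ii) $\Omega_{\{F_n\}}=\bigcup_{j\ge1}\Omega_j$ with $\Omega_j\subset\Omega_{j+1}$ and each $\Omega_j$ biholomorphic to the unit ball $B^k(0;1)$; (iii) the infinitesimal Kobayashi metric on $\Omega_{\{F_n\}}$ vanishes identically; (iv) there exists a plurisubharmonic function $\phi:\mathbb{C}^k\to[\log a,\infty)$ such that $\Omega_{\{F_n\}}=\{z\in\mathbb{C}^k:\phi(z)<0\}$. *)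

(* Defs.v *)
From HB Require Import structures.
From mathcomp Require Import all_boot all_order all_algebra.
From mathcomp Require Import complex.
From mathcomp Require Import all_classical all_reals all_analysis.
Import Order.TTheory GRing.Theory Num.Theory.
Import numFieldNormedType.Exports.

Set Implicit Arguments.
Unset Strict Implicit.
Unset Printing Implicit Defensive.

Local Open Scope ring_scope.
Local Open Scope classical_set_scope.
Local Open Scope complex_scope.

(* The complex numbers R[i] as a normed space over themselves (norm = modulus),
   copied from the regular algebra R[i]^o; this gives the usual topology on
   C and (via matrix_normedtype) on C^k = 'rV[R[i]]_k, and makes
   [differentiable] over the scalar field R[i] mean complex (Frechet)
   differentiability, i.e. holomorphy. *)
HB.instance Definition _ (R : rcfType) := NormedModule.copy R[i] R[i]^o.

Section Defs.
Variable R : realType.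
Local Notation C := R[i].

Definition coord (k : nat) (z : 'rV[C]_k) (j : nat) : C :=
  if @insub nat (fun j => j < k)%N 'I_k j is Some i then z ord0 i else 0.

Definition Fmap (k d : nat) (eta : C) (z : 'rV[C]_k) : 'rV[C]_k :=
  \row_(i < k) (if (i == 0 :> nat) then eta * coord z k.-1
                else coord z i ^+ d + eta * coord z i.-1).

Fixpoint Fcomp (k d : nat) (eta : nat -> C) (n : nat) (z : 'rV[C]_k) : 'rV[C]_k :=
  match n with
  | 0 => Fmap d (eta 0%N) z
  | n'.+1 => Fmap d (eta n) (Fcomp d eta n' z)
  end.

Definition basin (k d : nat) (eta : nat -> C) : set 'rV[C]_k :=
  [set z | (fun n => Fcomp d eta n z) @ \oo --> (0 : 'rV[C]_k)].

Definition holo_on (V W : normedModType C) (U : set V) (f : V -> W) :=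
  forall x, U x -> differentiable f x.

Definition biholomorphic (k : nat) (U V : set 'rV[C]_k) :=
  exists (f g : 'rV[C]_k -> 'rV[C]_k),
    [/\ holo_on U f, holo_on V g, (f @` U `<=` V), (g @` V `<=` U) &
        ((forall x, U x -> g (f x) = x) /\ (forall y, V y -> f (g y) = y))].

Definition unit_ball (k : nat) : set 'rV[C]_k :=
  [set z | \sum_(i < k) `|z ord0 i| ^+ 2 < 1].

Definition unit_disc : set C := [set w | `|w| < 1].

Definition kobayashi (k : nat) (U : set 'rV[C]_k) (p v : 'rV[C]_k) : R :=
  inf [set alpha : R | 0 < alpha /\
        exists f : C -> 'rV[C]_k,
          [/\ holo_on unit_disc f, (f @` unit_disc `<=` U), f 0 = p &
              'D_1 f 0 = (alpha^-1)%:C *: v]].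

Definition usc (T : topologicalType) (u : T -> R) :=
  forall x c, u x < c -> \forall y \near x, u y < c.

Definition period_itv : set R := `[0, 2 * pi]%classic.

Definition subharmonic (u : C -> R) :=
  usc u /\
  forall z0 : C, exists2 rho : R, 0 < rho &
    forall r : R, 0 < r < rho ->
      ((u z0)%:E <= ((2 * pi)^-1)%:E *
         \int[lebesgue_measure]_(t in period_itv)
            (u (z0 + r%:C * (cos t +i* sin t)))%:E)%E.

Definition psh (k : nat) (phi : 'rV[C]_k -> R) :=
  usc phi /\ forall z w : 'rV[C]_k, subharmonic (fun l : C => phi (z + l *: w)).

End Defs.

Arguments basin {R} k d eta.
Arguments unit_ball {R} k.

(* Main.v *)
(** Each [F_n] is a polynomial automorphism of C^k, and as soon as [eta_n] is
    small it maps the Euclidean ball of squared radius [1/(8k)] into itself,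
    at least halving the squared norm.  The basin is therefore the increasing
    union of the preimages of that ball under [F(n)], each biholomorphic to a
    ball; it is connected because the preimage of a segment ending at 0 is a
    path inside the basin.

    Along the orbit of a point [p] of the basin the derivative of [F(n)] tends
    to 0 (here [d >= 2] is used), so for any [alpha > 0] the disc
    [l |-> F(n)^-1 (F(n) p + l * alpha^-1 * DF(n)(p) v)] stays in the basin for
    large [n]; hence the Kobayashi metric vanishes.

    With [M_n z = max (a^(d^n), |F(n) z|)] one has [M_(n+1) <= 2 * M_n^d], so
    [d^-n * (ln M_n + ln 2 / (d-1))] decreases to a function [phi >= ln a] that
    is negative exactly on the basin.  The sub-mean value property of the
    approximants reduces to Jensen's inequality for [ln (max (c, |P|))] with [P]
    a polynomial: on a circle each linear factor of [P] has modulus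
    [A * |1 - g * z|] with [|g| <= 1], and the mean of [ln |1 - g * z|] vanishes
    for [|g| < 1].  The case [|g| = 1] and the limit in [n] follow by dominated
    convergence. *)

Require Import Defs.
From HB Require Import structures.
From mathcomp Require Import all_boot all_order all_algebra.
From mathcomp Require Import complex.
From mathcomp Require Import ring lra zify.
From mathcomp Require Import all_classical all_reals all_analysis.
From mathcomp Require Import measurable_realfun.
Import Order.TTheory GRing.Theory Num.Theory.
Import numFieldNormedType.Exports.
Local Open Scope ring_scope.
Local Open Scope classical_set_scope.
Local Open Scope complex_scope.
Set Implicit Arguments.
Unset Strict Implicit.
Unset Printing Implicit Defensive.

Import Normc.

(** * Topology of C and C^k *)

Section ComplexTopology.
Variable R : realType.
Local Notation C := R[i].

(** The order of [R[i]] compares only numbers with equal imaginary parts, so a positive radius in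
    the topology of [C] is real; epsilons can thus be moved to [R]. *)
Lemma gt0_complexE (e : C) : 0 < e -> e = (complex.Re e)%:C /\ 0 < complex.Re e.
Proof. by case: e => x y; rewrite ltcE /= => /andP[/eqP -> ?]. Qed.

Lemma normc_ge0 (z : C) : 0 <= normc z.
Proof. by case: z => x y /=; exact: sqrtr_ge0. Qed.

Lemma normc_re (x : R) : normc x%:C = `|x|.
Proof. by rewrite /= expr0n addr0 sqrtr_sqr. Qed.

Lemma normcX (z : C) n : normc (z ^+ n) = normc z ^+ n.
Proof. by elim: n => [|n IH]; rewrite ?normc1 // !exprS normcM IH. Qed.

Lemma normc_gt0 (z : C) : z != 0 -> 0 < normc z.
Proof.
move=> z0; rewrite lt_neqAle normc_ge0 andbT eq_sym.
by apply: contra z0 => /eqP/eq0_normc ->.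
Qed.

Lemma normc_le_ReIm (x y : R) : normc (x +i* y) <= `|x| + `|y|.
Proof.
have -> : x +i* y = x%:C + (0 +i* y) by rewrite /GRing.add /= addr0 add0r.
apply: le_trans (le_normcD _ _) _.
by rewrite normc_re lerD2l /= expr0n add0r sqrtr_sqr.
Qed.

Lemma sqr_normcD (x y : C) : normc (x + y) ^+ 2 <= 2 * (normc x ^+ 2 + normc y ^+ 2).
Proof.
have H := le_normcD x y; have Ht := normc_ge0 (x + y).
have := sqr_ge0 (normc x - normc y); nra.
Qed.

Lemma normc_continuous : continuous (@normc R : C -> R).
Proof.
move=> x; apply/(@cvgrPdist_lt _ _ _ _ (nbhs_filter x)) => e e0.
apply/nbhs_ballP; exists e%:C => /=; first by rewrite ltcR.
move=> y; rewrite /ball /= ltcR => xy.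
apply: le_lt_trans xy.
have H := le_normcD (x - y) y; have H' := le_normcD (y - x) x.
rewrite !subrK in H H'; rewrite -(normcN (y - x)) opprB in H'.
by rewrite ler_norml; apply/andP; split; lra.
Qed.

Lemma cvg_complexP (T : Type) (F : set_system T) (FF : Filter F) (f : T -> C) (l : C) :
  (fun x => normc (l - f x)) @ F --> (0 : R) -> f @ F --> l.
Proof.
move=> /cvgrPdist_lt H; apply/cvgrPdist_lt => e /gt0_complexE [-> e0].
near=> x; rewrite ltcR.
have : `|0 - normc (l - f x)| < complex.Re e by near: x; exact: H.
by rewrite sub0r normrN ger0_norm // normc_ge0.
Unshelve. all: end_near. Qed.

Lemma continuous_ReIm (T : topologicalType) (f g : T -> R) (x : T) :
  {for x, continuous f} -> {for x, continuous g} ->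
  {for x, continuous (fun t => f t +i* g t : C)}.
Proof.
move=> cf cg; apply: cvg_complexP.
have H : (fun t => `|f x - f t| + `|g x - g t|) @ x --> (0 : R).
  rewrite -[X in _ --> X](addr0 (0 : R)); apply: cvgD.
    rewrite -(@normr0 _ R) -(subrr (f x)); apply: cvg_norm.
    by apply: cvgB => //; exact: cvg_cst.
  rewrite -(@normr0 _ R) -(subrr (g x)); apply: cvg_norm.
  by apply: cvgB => //; exact: cvg_cst.
apply: (squeeze_cvgr _ (cvg_cst 0) H); near=> t.
by rewrite normc_ge0 /=; exact: normc_le_ReIm.
Unshelve. all: end_near. Qed.

Lemma cvg_rowP (T : Type) (F : set_system T) (FF : Filter F) (k : nat)
    (f : T -> 'rV[C]_k) (l : 'rV[C]_k) :
  (forall i, (fun x => f x ord0 i) @ F --> (l ord0 i : C)) -> f @ F --> l.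
Proof.
move=> H; apply/cvg_ballP => e e0.
have : \forall x \near F, forall i, ball (l ord0 i) e (f x ord0 i).
  apply: filter_forall => i.
  by move/cvg_ballP : (H i) => /(_ _ e0).
apply: filterS => x Hx; split => //= i j; rewrite (ord1 i); exact: Hx.
Qed.

Lemma row_coord_continuous (k : nat) (i : 'I_k) :
  continuous (fun z : 'rV[C]_k => z ord0 i : C).
Proof. exact: coord_continuous. Qed.

Lemma continuous_scale_re (V : normedModType C) (x : V) :
  continuous (fun t : R => t%:C *: x).
Proof.
move=> t; apply: cvgZr_tmp; apply: continuous_ReIm; first exact: cvg_id.
exact: cvg_cst.
Qed.

End ComplexTopology.

(** * The squared Euclidean norm on C^k *)

Section Sqnorm.
Variable R : realType.
Local Notation C := R[i].
Implicit Types k : nat.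

(** The built-in norm of ['rV[C]_k] is a maximum with values in [C]; the estimates and the
    comparison with [unit_ball] call for a real Euclidean quantity. *)
Definition sqnorm k (z : 'rV[C]_k) : R := \sum_i normc (z ord0 i) ^+ 2.

Lemma sqnorm_ge0 k (z : 'rV[C]_k) : 0 <= sqnorm z.
Proof. by apply: sumr_ge0 => i _; rewrite sqr_ge0. Qed.

Lemma normc_le_sqnorm k (z : 'rV[C]_k) i : normc (z ord0 i) ^+ 2 <= sqnorm z.
Proof.
rewrite /sqnorm (bigD1 i) //= lerDl.
by apply: sumr_ge0 => j _; rewrite sqr_ge0.
Qed.

Lemma sqnorm_continuous k : continuous (@sqnorm k).
Proof.
apply: continuous_big => [|i _]; first exact: add_continuous.
move=> z; apply: (@continuous_comp _ _ _ (fun z : 'rV[C]_k => normc (z ord0 i)) (fun x => x ^+ 2)).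
  apply: (@continuous_comp _ _ _ (fun z : 'rV[C]_k => z ord0 i : C) (@normc R)).
    exact: row_coord_continuous.
  exact: normc_continuous.
exact: exprn_continuous.
Qed.

Lemma sqnorm0 k : sqnorm (0 : 'rV[C]_k) = 0.
Proof. by rewrite /sqnorm big1 // => i _; rewrite mxE normc0 expr0n. Qed.

Lemma sqnormZ k (c : C) (z : 'rV[C]_k) : sqnorm (c *: z) = normc c ^+ 2 * sqnorm z.
Proof.
by rewrite /sqnorm mulr_sumr; apply: eq_bigr => i _; rewrite mxE normcM exprMn.
Qed.

Lemma sqnormD k (z w : 'rV[C]_k) : sqnorm (z + w) <= 2 * (sqnorm z + sqnorm w).
Proof.
rewrite /sqnorm -big_split /= mulr_sumr; apply: ler_sum => i _; rewrite mxE.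
exact: sqr_normcD.
Qed.

Lemma sqnorm_cvg0 (T : Type) (F : set_system T) (FF : Filter F) k
    (f : T -> 'rV[C]_k) :
  (fun x => sqnorm (f x)) @ F --> (0 : R) -> f @ F --> (0 : 'rV[C]_k).
Proof.
move=> H; apply: cvg_rowP => i; apply: cvg_complexP; rewrite mxE.
apply/cvgrPdist_lt => e e0; near=> x.
rewrite !sub0r normcN normrN ger0_norm ?normc_ge0 //.
rewrite -(ltr_pXn2r (n := 2)) ?nnegrE ?normc_ge0 ?(ltW e0) //.
apply: le_lt_trans (normc_le_sqnorm _ _) _.
have : `|0 - sqnorm (f x)| < e ^+ 2.
  by near: x; move/cvgrPdist_lt : H; apply; rewrite exprn_gt0.
by rewrite sub0r normrN ger0_norm ?sqnorm_ge0.
Unshelve. all: end_near. Qed.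

Lemma unit_ballE k (z : 'rV[C]_k) : unit_ball k z <-> sqnorm z < 1.
Proof.
rewrite /unit_ball /=.
suff -> : \sum_(i < k) `|z ord0 i| ^+ 2 = (sqnorm z)%:C by rewrite -(ltcR (sqnorm z) 1).
rewrite /sqnorm rmorph_sum /=; apply: eq_bigr => i _.
by rewrite rmorphXn.
Qed.

End Sqnorm.

(** * Complex differentials of vector-valued maps *)

Section HolomorphicRows.
Variable R : realType.
Local Notation C := R[i].

Lemma differentiable_row (V : normedModType C) (k : nat) (f : V -> 'rV[C]_k) (x : V) :
 (forall i, differentiable (fun z => f z ord0 i : C) x) -> differentiable f x.
Proof.
move=> H.
have -> : f = \sum_i (fun z => f z ord0 i *: delta_mx ord0 i).
  by apply/funext => z; rewrite [LHS]row_sum_delta fct_sumE.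
apply: differentiable_sum => i.
exact: differentiableZl.
Qed.

Lemma differentiable_row_coord (k : nat) (i : 'I_k) (z : 'rV[C]_k) :
  differentiable (fun z : 'rV[C]_k => z ord0 i : C) z.
Proof. exact: differentiable_coord. Qed.

(** A coordinate projection is linear and continuous, hence its own differential; packing it as a
    linear map makes the chain rule and [diff_lin] applicable. *)
Lemma diff_row_coord (V : normedModType C) (k : nat) (f : V -> 'rV[C]_k) (x v : V) i :
  differentiable f x ->
  ('d f x v) ord0 i = 'd (fun z => f z ord0 i : C) x v.
Proof.
move=> df.
have lin : linear (fun z : 'rV[C]_k => z ord0 i : C) by move=> c y z; rewrite !mxE.
pose L : {linear 'rV[C]_k -> C} :=
  HB.pack (fun z : 'rV[C]_k => z ord0 i : C) (GRing.isLinear.Build _ _ _ _ _ lin).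
have -> : (fun z => f z ord0 i : C) = L \o f by [].
have cL : continuous L by exact: row_coord_continuous.
have dL : differentiable L (f x) by exact: linear_differentiable.
by rewrite (diff_comp df dL) diff_lin.
Qed.

Lemma diff_compE (U V W : normedModType C) (f : U -> V) (g : V -> W) x v :
  differentiable f x -> differentiable g (f x) ->
  'd (g \o f) x v = 'd g (f x) ('d f x v).
Proof. by move=> df dg; rewrite (diff_comp df dg). Qed.

Lemma diff_cancel (U V : normedModType C) (f : U -> V) (g : V -> U) x v :
  cancel f g -> differentiable f x -> differentiable g (f x) ->
  'd g (f x) ('d f x v) = v.
Proof.
move=> fK df dg; rewrite -(diff_compE v df dg).
have -> : g \o f = id by apply/funext => y /=; rewrite fK.
by rewrite (@diff_val _ _ _ _ _ _ _ (is_diff_id x)).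
Qed.

End HolomorphicRows.

(** * The automorphisms *)

Section Automorphisms.
Variables (R : realType) (k d : nat).
Local Notation C := R[i].
Hypothesis k_gt1 : (1 < k)%N.
Local Notation coord := Defs.coord.
Implicit Types (z w : 'rV[C]_k) (e : C).

Lemma coord_ord z (i : 'I_k) : coord z i = z ord0 i.
Proof. by rewrite /coord insubT // => p; congr (z _ _); exact: val_inj. Qed.

Lemma coordE (f : 'I_k -> C) j (jk : (j < k)%N) :
  coord (\row_i f i) j = f (Ordinal jk).
Proof. by rewrite -[j]/(val (Ordinal jk)) coord_ord mxE. Qed.

(** Since [coord] takes the default value 0 out of range, this dichotomy gives facts for every
    natural index, with no range condition on [k.-1] or [i.-1]. *)
Lemma coord_cases j :
  (exists i : 'I_k, forall z, coord z j = z ord0 i) \/ (forall z, coord z j = 0).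
Proof.
case: (ltnP j k) => jk; [left|right].
  by exists (Ordinal jk) => z; rewrite -coord_ord.
by move=> z; rewrite /coord insubF // ltnNge jk.
Qed.

Lemma differentiable_coordn j z : differentiable (fun z => coord z j) z.
Proof.
case: (coord_cases j) => [[i H]|H]; rewrite (funext H).
  exact: differentiable_row_coord.
exact: differentiable_cst.
Qed.

Lemma normc_coord_le z j : normc (coord z j) ^+ 2 <= sqnorm z.
Proof.
case: (coord_cases j) => [[i H]|H]; rewrite H; first exact: normc_le_sqnorm.
by rewrite normc0 expr0n sqnorm_ge0.
Qed.

(* [Fmap_back e w m] is the coordinate [k - 1 - m] of the preimage of [w]:
   the last coordinate is read off [w_0], and the others in decreasing order. *)
Fixpoint Fmap_back e w m : C :=
  if m is m'.+1 then e^-1 * (coord w (k.-1 - m') - Fmap_back e w m' ^+ d)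
  else e^-1 * coord w 0.

Definition Fmap_inv e w : 'rV[C]_k := \row_(j < k) Fmap_back e w (k.-1 - j).

Lemma differentiable_pow (V : normedModType C) (f : V -> C) n x :
  differentiable f x -> differentiable (fun y => f y ^+ n) x.
Proof.
case: n => [|n] df; first exact: differentiable_cst.
have -> : (fun y => f y ^+ n.+1) = f ^+ n.+1 by rewrite exprfctE.
exact: differentiableX.
Qed.

Lemma FmapK e : e != 0 -> cancel (@Fmap R k d e) (Fmap_inv e).
Proof.
move=> e0 z.
(* Descending recursion: once coordinate [k.-1 - m] is known, its [d]-th power is subtracted from
   the same coordinate of the image, leaving [e] times the preceding one. *)
have H m : (m < k)%N -> Fmap_back e (Fmap d e z) m = coord z (k.-1 - m).
  elim: m => [|m IH] mk /=.
    by rewrite /Fmap (coordE _ mk) /= subn0 mulKf.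
  have lt : (k.-1 - m < k)%N by lia.
  have /negPf n0 : (k.-1 - m != 0)%N by lia.
  rewrite IH; last by lia.
  rewrite /Fmap (coordE _ lt) /= n0 addrC addKr mulKf //; congr coord; lia.
apply/rowP => j; rewrite mxE H; last by have := ltn_ord j; lia.
rewrite -coord_ord; congr coord; have := ltn_ord j; lia.
Qed.

Lemma Fmap_invK e : e != 0 -> cancel (Fmap_inv e) (@Fmap R k d e).
Proof.
move=> e0 w; apply/rowP => i; rewrite mxE; have ik := ltn_ord i.
case: eqP => i0.
  have lt : (k.-1 < k)%N by lia.
  by rewrite /Fmap_inv (coordE _ lt) /= subnn /= mulVKf // -coord_ord i0.
have lt : (i.-1 < k)%N by lia.
rewrite /Fmap_inv (coordE _ ik) (coordE _ lt) /=.
have -> : (k.-1 - i.-1 = (k.-1 - i).+1)%N by lia.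
rewrite /= mulVKf // addrC subrK.
have -> : (k.-1 - (k.-1 - i) = i)%N by lia.
exact: coord_ord.
Qed.

Lemma differentiable_Fmap e z : differentiable (@Fmap R k d e) z.
Proof.
apply: differentiable_row => i.
have -> : (fun z => Fmap d e z ord0 i) = (fun z => if (i == 0 :> nat) then e * coord z k.-1
                else coord z i ^+ d + e * coord z i.-1).
  by apply/funext => y; rewrite mxE.
case: eqP => _; last apply: differentiableD.
- apply: differentiableM; [exact: differentiable_cst|exact: differentiable_coordn].
- by apply: differentiable_pow; exact: differentiable_coordn.
- apply: differentiableM; [exact: differentiable_cst|exact: differentiable_coordn].
Qed.

Lemma differentiable_Fmap_inv e w : differentiable (Fmap_inv e) w.
Proof.
apply: differentiable_row => i.
have H m : differentiable (fun w => Fmap_back e w m) w.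
  elim: m => [|m IH] /=; apply: differentiableM; try exact: differentiable_cst.
    exact: differentiable_coordn.
  apply: differentiableB; first exact: differentiable_coordn.
  exact: differentiable_pow.
have -> : (fun w => Fmap_inv e w ord0 i) = (fun w => Fmap_back e w (k.-1 - i)).
  by apply/funext => y; rewrite mxE.
exact: H.
Qed.

Lemma is_diff_coordn j z :
  is_diff z (fun y : 'rV[C]_k => coord y j) (fun v => coord v j).
Proof.
apply: DiffDef; first exact: differentiable_coordn.
case: (coord_cases j) => [[l H]|H]; last by rewrite (funext H) diff_cst.
apply/funext => v; rewrite (funext H) H.
by rewrite -(@diff_row_coord _ _ _ id) // diff_val.
Qed.

Lemma diff_Fmap e z v (i : 'I_k) : (0 < d)%N -> (i != 0 :> nat) ->
  ('d (@Fmap R k d e) z v) ord0 i =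
  e * coord v i.-1 + d%:R * coord z i ^+ d.-1 * coord v i.
Proof.
move=> d0 i0; rewrite diff_row_coord; last exact: differentiable_Fmap.
have cdiff := is_diff_coordn.
(* The coordinate is rewritten with operations on functions and the exponent [d.-1.+1], the shape
   expected by the differentiation rules. *)
have -> : (fun z => Fmap d e z ord0 i) =
    (e *: (fun z => coord z i.-1 : C)) + (fun z => coord z i : C) ^+ d.-1.+1.
  apply/funext => y; rewrite mxE (negPf i0) prednK // exprfctE addrC.
  by [].
have D := is_diffD (is_diffZ e (cdiff i.-1 z)) (is_diffX d.-1 (cdiff i z)).
by rewrite (@diff_val _ _ _ _ _ _ _ D) prednK.
Qed.

Lemma diff_Fmap0 e z v (i : 'I_k) : (i = 0 :> nat) ->
  ('d (@Fmap R k d e) z v) ord0 i = e * coord v k.-1.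
Proof.
move=> i0; rewrite diff_row_coord; last exact: differentiable_Fmap.
have cdiff := is_diff_coordn.
have -> : (fun z => Fmap d e z ord0 i) = e *: (fun z => coord z k.-1 : C).
  by apply/funext => y; rewrite mxE i0.
by rewrite (@diff_val _ _ _ _ _ _ _ (is_diffZ e (cdiff k.-1 z))).
Qed.

End Automorphisms.

(** * Dynamics near the origin *)

Lemma halving_cvg0 (R : realType) (u : R^nat) (N : nat) :
  (forall n, 0 <= u n) -> (forall n, (N <= n)%N -> u n.+1 <= u n / 2) ->
  u @ \oo --> (0 : R).
Proof.
move=> u0 uN; rewrite -(cvg_shiftn N).
have H n : u (n + N)%N <= u N * 2^-1 ^+ n.
  elim: n => [|n IH]; first by rewrite expr0 mulr1 add0n.
  rewrite addSn exprSr mulrA; apply: le_trans (uN _ (leq_addl _ _)) _.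
  by rewrite ler_pM2r // invr_gt0.
have G : (fun n => u N * 2^-1 ^+ n) @ \oo --> (0 : R).
  rewrite -[X in _ --> X](mulr0 (u N)); apply: cvgM; first exact: cvg_cst.
  by apply: cvg_expr; rewrite ger0_norm ?invr_ge0 // invf_lt1 // ltr1n.
apply: (squeeze_cvgr _ (cvg_cst 0) G); near=> n.
by rewrite u0 /=; exact: H.
Unshelve. all: end_near. Qed.

Section Dynamics.
Variables (R : realType) (k d : nat) (eta : nat -> R[i]).
Local Notation C := R[i].
Local Notation coord := Defs.coord.
Hypothesis k_gt1 : (1 < k)%N.
Hypothesis d_gt1 : (1 < d)%N.
Hypothesis eta_neq0 : forall n, eta n != 0.
Hypothesis eta_cvg0 : (fun n => normc (eta n)) @ \oo --> (0 : R).
Implicit Types (z w p v : 'rV[C]_k).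

Local Notation F := (@Fcomp R k d eta).

Fixpoint Fcomp_inv n w : 'rV[C]_k :=
  if n is n'.+1 then Fcomp_inv n' (Fmap_inv d (eta n) w)
  else Fmap_inv d (eta 0%N) w.

Lemma FcompK n : cancel (F n) (Fcomp_inv n).
Proof. by elim: n => [|n IH] z /=; rewrite FmapK. Qed.

Lemma Fcomp_invK n : cancel (Fcomp_inv n) (F n).
Proof. by elim: n => [|n IH] w /=; rewrite ?IH Fmap_invK. Qed.

Lemma differentiable_Fcomp n z : differentiable (F n) z.
Proof.
elim: n => [|n IH]; first exact: differentiable_Fmap.
exact: (differentiable_comp IH (differentiable_Fmap d _ _)).
Qed.

Lemma differentiable_Fcomp_inv n w : differentiable (Fcomp_inv n) w.
Proof.
elim: n w => [|n IH] w; first exact: differentiable_Fmap_inv.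
exact: (differentiable_comp (differentiable_Fmap_inv d _ _) (IH _)).
Qed.

Lemma Fcomp_continuous n : continuous (F n).
Proof. by move=> z; apply: differentiable_continuous; exact: differentiable_Fcomp. Qed.

Lemma Fcomp_inv_continuous n : continuous (Fcomp_inv n).
Proof. by move=> z; apply: differentiable_continuous; exact: differentiable_Fcomp_inv. Qed.

Lemma Fmap0 e : Fmap d e (0 : 'rV[C]_k) = 0.
Proof.
have c0 j : coord (0 : 'rV[C]_k) j = 0.
  by case: (coord_cases R k j) => [[i H]|H]; rewrite H ?mxE.
have /negPf d0 : d != 0%N by lia.
by apply/rowP => i; rewrite !mxE !c0 expr0n d0 mulr0 addr0 if_same.
Qed.

Lemma Fcomp0 n : F n 0 = 0.
Proof. by elim: n => [|n IH] /=; rewrite ?IH Fmap0. Qed.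

(** In the unit ball [d >= 2] gives |z_i|^(2d) <= [sqnorm z ^+ 2], so each squared coordinate of the
    image carries a small factor; summing over the coordinates yields [k]. *)
Lemma sqnorm_Fmap e z : sqnorm z <= 1 ->
  sqnorm (Fmap d e z) <= 2 * k%:R * (sqnorm z + normc e ^+ 2) * sqnorm z.
Proof.
move=> z1.
have B (i : 'I_k) : normc (Fmap d e z ord0 i) ^+ 2 <= 2 * (sqnorm z + normc e ^+ 2) * sqnorm z.
  have S0 := sqnorm_ge0 z; have e0 := sqr_ge0 (normc e).
  rewrite mxE; case: eqP => _.
    have H := normc_coord_le z k.-1.
    by rewrite normcM exprMn; nra.
  apply: le_trans (sqr_normcD _ _) _; rewrite normcM exprMn normcX.
  have H1 := normc_coord_le z i; have H2 := normc_coord_le z i.-1.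
  have H3 : (normc (coord z i) ^+ d) ^+ 2 <= sqnorm z ^+ 2.
    rewrite -exprM mulnC exprM.
    apply: (@le_trans _ _ ((normc (coord z i) ^+ 2) ^+ 2)).
      by apply: ler_wiXn2l => //; rewrite ?sqr_ge0 // (le_trans H1).
    by rewrite lerXn2r ?nnegrE ?sqr_ge0.
  have := ler_wpM2l e0 H2; nra.
rewrite {1}/sqnorm; apply: le_trans (ler_sum _ (fun i _ => B i)) _.
by rewrite sumr_const card_ord -mulr_natl; rewrite le_eqVlt; apply/predU1P; left; ring.
Qed.

(** The derivative d * z_i^(d-1) keeps at least one factor z_i because [d >= 2]; hence the
    differential itself is small when both [z] and [e] are. *)
Lemma sqnorm_diff_Fmap e z v : sqnorm z <= 1 ->
  sqnorm ('d (@Fmap R k d e) z v) <=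
  2 * k%:R * (normc e ^+ 2 + d%:R ^+ 2 * sqnorm z) * sqnorm v.
Proof.
move=> z1.
have B (i : 'I_k) : normc (('d (@Fmap R k d e) z v) ord0 i) ^+ 2 <=
    2 * (normc e ^+ 2 + d%:R ^+ 2 * sqnorm z) * sqnorm v.
  have S0 := sqnorm_ge0 z; have V0 := sqnorm_ge0 v; have e0 := sqr_ge0 (normc e).
  have D0 : 0 <= d%:R ^+ 2 * sqnorm z by rewrite mulr_ge0 ?sqr_ge0.
  have [/eqP i0|i0] := boolP (i == 0 :> nat).
    have H := normc_coord_le v k.-1.
    rewrite diff_Fmap0 // normcM exprMn.
    by have := ler_wpM2l e0 H; have := mulr_ge0 D0 V0; have := mulr_ge0 e0 V0; nra.
  rewrite diff_Fmap // ?(ltnW d_gt1) //.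
  apply: le_trans (sqr_normcD _ _) _; rewrite !normcM !exprMn normcX.
  have -> : normc d%:R = d%:R :> R by rewrite -(rmorph_nat (real_complex R)) normc_re normr_nat.
  have H1 := normc_coord_le v i; have H2 := normc_coord_le v i.-1.
  have H4 := normc_coord_le z i.
  have H3 : (normc (coord z i) ^+ d.-1) ^+ 2 <= sqnorm z.
    rewrite -exprM mulnC exprM; apply: le_trans H4.
    rewrite -[X in _ <= X]expr1.
    apply: ler_wiXn2l => //; rewrite ?sqr_ge0 //; last by rewrite -ltnS prednK // (ltnW d_gt1).
    by rewrite (le_trans (normc_coord_le z i)).
  have H5 : (normc (coord z i) ^+ d.-1) ^+ 2 * normc (coord v i) ^+ 2 <= sqnorm z * sqnorm v.
    by apply: ler_pM => //; exact: sqr_ge0.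
  have H6 := ler_wpM2l (sqr_ge0 (d%:R : R)) H5.
  by have := ler_wpM2l e0 H2; nra.
rewrite {1}/sqnorm; apply: le_trans (ler_sum _ (fun i _ => B i)) _.
by rewrite sumr_const card_ord -mulr_natl; rewrite le_eqVlt; apply/predU1P; left; ring.
Qed.

(** Chosen so that 2 * k * (radius + radius) = 1/2, the contraction factor obtained from
    [sqnorm_Fmap] when both [sqnorm z] and |e|^2 are at most [radius]. *)
Definition radius : R := (8 * k%:R)^-1.

Lemma k_gt0R : 0 < k%:R :> R.
Proof. by rewrite ltr0n (ltnW k_gt1). Qed.

Lemma radius_gt0 : 0 < radius.
Proof. by rewrite invr_gt0 mulr_gt0 // k_gt0R. Qed.

Lemma radius_le1 : radius <= 1.
Proof.
have : 1 <= k%:R :> R by rewrite ler1n (ltnW k_gt1).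
by move=> H; rewrite invf_le1; lra.
Qed.

Lemma k_radius : k%:R * radius = 8^-1.
Proof. by rewrite /radius; field; rewrite gt_eqF // k_gt0R. Qed.

Lemma eta_small : exists N, forall n, (N <= n)%N -> normc (eta n) ^+ 2 <= radius.
Proof.
have H : (fun n => normc (eta n) ^+ 2) @ \oo --> (0 : R).
  rewrite -[X in _ --> X](mulr0 (0 : R)); exact: cvgM.
move/cvgrPdist_le : H => /(_ _ radius_gt0) [N _ HN]; exists N => n Nn.
by have := HN n Nn; rewrite /= sub0r normrN ger0_norm ?sqr_ge0.
Qed.

Lemma basin_sqnorm z : basin k d eta z <-> (fun n => sqnorm (F n z)) @ \oo --> (0 : R).
Proof.
split; last exact: sqnorm_cvg0.
move=> H; have C0 : sqnorm x @[x --> (0 : 'rV[C]_k)] --> (0 : R).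
  by rewrite -[X in _ --> X](sqnorm0 R k); exact: sqnorm_continuous.
exact: (cvg_comp _ _ H C0).
Qed.

Lemma halving_step z n : normc (eta n.+1) ^+ 2 <= radius -> sqnorm (F n z) <= radius ->
  sqnorm (F n.+1 z) <= sqnorm (F n z) / 2.
Proof.
move=> e1 S1.
apply: le_trans (sqnorm_Fmap _ (le_trans S1 radius_le1)) _.
have := sqnorm_ge0 (F n z); have := k_radius; have := k_gt0R => K KR S0.
have : k%:R * (sqnorm (F n z) + normc (eta n.+1) ^+ 2) <= 4^-1.
  have : k%:R * (sqnorm (F n z) + normc (eta n.+1) ^+ 2) <= k%:R * (radius + radius).
    by rewrite ler_pM2l // lerD.
  by move=> H; apply: le_trans H _; rewrite mulrDr KR; lra.
by nra.
Qed.

(** * Exhaustion of the basin by preimages of the small ball *)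

Section Trap.
Variable N : nat.
Hypothesis HN : forall n, (N <= n)%N -> normc (eta n) ^+ 2 <= radius.

Lemma trap_step z n : (N <= n)%N -> sqnorm (F n z) < radius ->
  sqnorm (F n.+1 z) <= sqnorm (F n z) / 2.
Proof. by move=> Nn S1; apply: halving_step; [apply: HN; exact: leqW|exact: ltW]. Qed.

Lemma trap_mono z n m : (N <= n)%N -> (n <= m)%N -> sqnorm (F n z) < radius ->
  sqnorm (F m z) < radius.
Proof.
move=> Nn + H; elim: m => [|m IH]; first by rewrite leqn0 => /eqP <-.
rewrite leq_eqVlt => /orP[/eqP <- //|]; rewrite ltnS => nm.
have := trap_step (leq_trans Nn nm) (IH nm).
by have := IH nm; have := sqnorm_ge0 (F m z); lra.
Qed.

Lemma trap_basin z n : (N <= n)%N -> sqnorm (F n z) < radius -> basin k d eta z.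
Proof.
move=> Nn H; apply/basin_sqnorm; apply: (@halving_cvg0 _ _ n).
  by move=> m; exact: sqnorm_ge0.
move=> m nm; apply: trap_step; first exact: leq_trans nm.
exact: trap_mono nm H.
Qed.

(** The shift by [N] skips the maps that need not contract, so that these sets increase from [j = 0]
    on. *)
Definition trap j : set 'rV[C]_k := [set z | sqnorm (F (j + N) z) < radius].

(** An orbit tending to 0 eventually enters the ball; an orbit that is in the ball at a time past
    [N] never leaves it and is halved at each step. *)
Lemma basin_trap : basin k d eta = \bigcup_j trap j.
Proof.
apply/seteqP; split => z; last by move=> [j _]; apply: trap_basin; exact: leq_addl.
move=> /basin_sqnorm /cvgrPdist_lt /(_ _ radius_gt0) [m _ Hm].
exists m => //; rewrite /trap /=; have := Hm (m + N)%N (leq_addr _ _).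
by rewrite /= sub0r normrN ger0_norm ?sqnorm_ge0.
Qed.

Lemma trap_sub j : trap j `<=` trap j.+1.
Proof. by move=> z; apply: trap_mono; [exact: leq_addl|rewrite addSn]. Qed.

Lemma trap_open j : open (trap j).
Proof.
have -> : trap j = (sqnorm (k := k) \o F (j + N)) @^-1` [set x | x < radius] by [].
apply: open_comp; last exact: open_lt.
move=> z _; apply: continuous_comp; first exact: Fcomp_continuous.
exact: sqnorm_continuous.
Qed.

Lemma basin_open : open (basin k d eta).
Proof. by rewrite basin_trap; apply: bigcup_open => j _; exact: trap_open. Qed.

Lemma basin0 : basin k d eta 0.
Proof.
by rewrite basin_trap; exists 0%N => //; rewrite /trap /= Fcomp0 sqnorm0 radius_gt0.
Qed.

Lemma basin_connected : connected (basin k d eta).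
Proof.
have P z : basin k d eta z -> exists A : set 'rV[C]_k,
    [/\ connected A, A `<=` basin k d eta, A 0 & A z].
  rewrite {1}basin_trap => -[j _ jz].
  (* The segment from 0 to the image of [z], pulled back: at parameter [t] the squared norm of the
     image is [t ^+ 2] times that at [z], so the path stays in the same trap. *)
  pose g (t : R) := Fcomp_inv (j + N) (t%:C *: F (j + N) z).
  exists [set g x | x in `[0, 1]%classic]; split.
  - apply: connected_continuous_connected; first exact: segment_connected.
    apply: continuous_subspaceT => t.
    apply: (@continuous_comp _ _ _ (fun t : R => t%:C *: F (j + N) z) (Fcomp_inv (j + N))).
      exact: continuous_scale_re.
    exact: Fcomp_inv_continuous.
  - move=> _ [t /=] + <-; rewrite in_itv /= => /andP[t0 t1].
    rewrite basin_trap; exists j => //.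
    rewrite /trap /= /g Fcomp_invK sqnormZ normc_re ger0_norm //.
    apply: le_lt_trans jz; apply: ler_piMl; first exact: sqnorm_ge0.
    by rewrite expr_le1.
  - exists 0; first by rewrite /= in_itv /= lexx ler01.
    rewrite /g (_ : (0 : R)%:C = 0) // scale0r.
    by rewrite -[X in Fcomp_inv _ X](Fcomp0 (j + N)) FcompK.
  - exists 1; first by rewrite /= in_itv /= lexx ler01.
    by rewrite /g scale1r FcompK.
have -> : basin k d eta =
    \bigcup_(A in [set A : set 'rV[C]_k | [/\ connected A, A `<=` basin k d eta & A 0]]) A.
  apply/seteqP; split=> z; last by move=> [A [_ /(_ z) H _]].
  by move=> /P[A [cA sA A0 Az]]; exists A.
by apply: bigcup_connected => [|A []//]; exists 0 => A [].
Qed.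

Lemma trap_biholomorphic j : biholomorphic (trap j) (unit_ball k).
Proof.
(* [radius] bounds a squared norm, so scaling by the inverse of its square root carries the ball
   onto the unit ball. *)
pose c : R := Num.sqrt radius.
have c0 : 0 < c by rewrite sqrtr_gt0 radius_gt0.
have c2 : c ^+ 2 = radius by rewrite sqr_sqrtr // ltW // radius_gt0.
have cC : c%:C != 0 by rewrite (inj_eq (@complexI R)) gt_eqF.
exists (fun z => (c^-1)%:C *: F (j + N) z), (fun w => Fcomp_inv (j + N) (c%:C *: w)).
have E1 z : (c%:C *: ((c^-1)%:C *: z)) = z :> 'rV[C]_k.
  by rewrite scalerA -rmorphM /= divff ?gt_eqF // scale1r.
have E2 z : ((c^-1)%:C *: (c%:C *: z)) = z :> 'rV[C]_k.
  by rewrite scalerA -rmorphM /= mulVf ?gt_eqF // scale1r.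
split.
- by move=> z _; apply: differentiableZ; exact: differentiable_Fcomp.
- move=> z _; have dc : differentiable (fun w : 'rV[C]_k => c%:C *: w) z.
    by apply: differentiableZ.
  exact: (differentiable_comp dc (differentiable_Fcomp_inv _ _)).
- move=> _ [z Hz <-]; apply/unit_ballE.
  rewrite sqnormZ normc_re ger0_norm ?invr_ge0 ?(ltW c0) // exprVn c2.
  by rewrite mulrC ltr_pdivrMr ?radius_gt0 // mul1r.
- move=> _ [z /unit_ballE Hz <-]; rewrite /trap /= Fcomp_invK.
  rewrite sqnormZ normc_re ger0_norm ?(ltW c0) // c2.
  by rewrite gtr_pMr ?radius_gt0.
by split=> z _; rewrite ?E1 ?FcompK // Fcomp_invK E2.
Qed.

End Trap.

(** * Vanishing of the Kobayashi metric *)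

Lemma diff_Fcomp_cvg0 p v : basin k d eta p ->
  (fun n => sqnorm ('d (F n) p v)) @ \oo --> (0 : R).
Proof.
move=> /basin_sqnorm Hp.
have K := k_gt0R; have D0 : 0 <= (d%:R : R) ^+ 2 by exact: sqr_ge0.
(* The bound 1 is the hypothesis of [sqnorm_diff_Fmap]; the bound 1/(4k) turns its factor 2k(...)
   into at most 1/2, so the chain rule gives halving at each step. *)
have : \forall n \near \oo, sqnorm (F n p) < 1 /\
    normc (eta n.+1) ^+ 2 + d%:R ^+ 2 * sqnorm (F n p) < (4 * k%:R)^-1.
  have H : (fun n => normc (eta n.+1) ^+ 2 + d%:R ^+ 2 * sqnorm (F n p)) @ \oo --> (0 : R).
    rewrite -(addr0 (0 : R)); apply: cvgD.
      rewrite -[X in _ --> X](mulr0 (0 : R)).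
      by apply: cvgM; rewrite (cvg_shiftS (fun n => normc (eta n))).
    by rewrite -[X in _ --> X](mulr0 (d%:R ^+ 2 : R)); apply: cvgM => //; exact: cvg_cst.
  have e1 : 0 < (4 * k%:R)^-1 :> R by rewrite invr_gt0 mulr_gt0.
  move/cvgrPdist_lt : H => /(_ _ e1) H; move/cvgrPdist_lt : Hp => /(_ _ ltr01) H'.
  near=> n; split.
    have : `|0 - sqnorm (F n p)| < 1 by near: n; exact: H'.
    by rewrite sub0r normrN ger0_norm ?sqnorm_ge0.
  have : `|0 - (normc (eta n.+1) ^+ 2 + d%:R ^+ 2 * sqnorm (F n p))| < (4 * k%:R)^-1.
    by near: n; exact: H.
  by rewrite sub0r normrN; apply: le_lt_trans; exact: ler_norm.
move=> [N _ HN]; apply: (@halving_cvg0 _ _ N) => [n|n Nn]; first exact: sqnorm_ge0.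
have [S1 E] := HN n Nn.
have E' : sqnorm ('d (F n.+1) p v) =
    sqnorm ('d (@Fmap R k d (eta n.+1)) (F n p) ('d (F n) p v)).
  exact: (congr1 (@sqnorm R k) (diff_compE v (differentiable_Fcomp n p)
    (differentiable_Fmap d (eta n.+1) (F n p)))).
apply: (le_trans (eq_ind _ (fun x => sqnorm ('d (F n.+1) p v) <= x) (lexx _) _ E')).
move=> {E'}; apply: le_trans (sqnorm_diff_Fmap _ _ (ltW S1)) _.
have V0 := sqnorm_ge0 ('d (F n) p v).
rewrite mulrC; apply: ler_wpM2l => //.
apply: (@le_trans _ _ (2 * k%:R * (4 * k%:R)^-1)).
  by rewrite ler_pM2l ?mulr_gt0 // ltW.
by rewrite le_eqVlt; apply/predU1P; left; field; rewrite gt_eqF.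
Unshelve. all: end_near. Qed.

Lemma discs_exist p v (alpha : R) : basin k d eta p -> 0 < alpha ->
  exists f : C -> 'rV[C]_k,
    [/\ holo_on (unit_disc (R := R)) f, (f @` (unit_disc (R := R)) `<=` basin k d eta), f 0 = p &
        'D_1 f 0 = (alpha^-1)%:C *: v].
Proof.
move=> bp a0; have [N HN] := eta_small.
(* By [sqnormD] this quantity bounds the squared norm on the whole affine disc [q + l *: w] with |l|
   < 1, which therefore lies in the trapping ball. *)
have V : \forall n \near \oo, 2 * (sqnorm (F n p) + alpha^-1 ^+ 2 * sqnorm ('d (F n) p v)) < radius.
  have H : (fun n => 2 * (sqnorm (F n p) + alpha^-1 ^+ 2 * sqnorm ('d (F n) p v))) @ \oo --> (0 : R).
    rewrite -(mulr0 (2 : R)); apply: cvgM; first exact: cvg_cst.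
    rewrite -(addr0 (0 : R)); apply: cvgD; first exact/basin_sqnorm.
    rewrite -[X in _ --> X](mulr0 (alpha^-1 ^+ 2 : R)); apply: cvgM; first exact: cvg_cst.
    exact: diff_Fcomp_cvg0.
  move/cvgrPdist_lt : H => /(_ _ radius_gt0); apply: filterS => n.
  by rewrite sub0r normrN; apply: le_lt_trans; exact: ler_norm.
case: V => m _ Hm; have := Hm (m + N)%N (leq_addr _ _).
set n := (m + N)%N => Hn.
set q := F n p; set w := (alpha^-1)%:C *: 'd (F n) p v.
have dL (x : C) : differentiable (fun l : C => q + l *: w) x.
  apply: differentiableD; first exact: differentiable_cst.
  by apply: (@differentiableZl _ _ _ (fun l : C => l)).
have dG (x : C) := differentiable_comp (dL x) (differentiable_Fcomp_inv n (q + x *: w)).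
exists (Fcomp_inv n \o (fun l : C => q + l *: w)); split.
- by move=> x _; exact: dG.
- move=> _ [l Hl <-]; apply: (@trap_basin _ HN _ n); first exact: leq_addl.
  rewrite /= Fcomp_invK; apply: le_lt_trans (sqnormD _ _) (le_lt_trans _ Hn).
  rewrite ler_pM2l // lerD2l sqnormZ /w sqnormZ normc_re ger0_norm; last by rewrite invr_ge0 ltW.
  have l1 : normc l < 1 by rewrite -ltcR.
  apply: ler_piMl; first by rewrite mulr_ge0 ?sqr_ge0 ?sqnorm_ge0.
  by rewrite expr_le1 ?normc_ge0 // ltW.
- by rewrite /= scale0r addr0 FcompK.
have dI : differentiable (Fcomp_inv n) q by exact: differentiable_Fcomp_inv.
rewrite deriveE; last exact: dG.
have dI' : differentiable (Fcomp_inv n) (q + (0 : C) *: w) by rewrite scale0r addr0.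
rewrite (diff_comp (dL 0) dI') /= scale0r addr0.
have -> : 'd (fun l : C => q + l *: w) 0 1 = w.
  have D : is_diff (0 : C) (cst q + (fun l : C => l *: w)) (0 + (fun l : C => l *: w)).
    exact: is_diffD.
  rewrite (_ : (fun l : C => q + l *: w) = cst q + (fun l : C => l *: w)) //.
  by rewrite (@diff_val _ _ _ _ _ _ _ D) /= add0r scale1r.
(* What remains is the differential of the inverse applied to that of [F n], evaluated at [v]; the
   two cancel. *)
rewrite /w linearZ; congr (_ *: _).
exact: (diff_cancel v (@FcompK n) (differentiable_Fcomp n p) dI).
Qed.

(** Every positive [alpha] is admissible by [discs_exist], so 0 is the true infimum of a non-empty
    set bounded below, not the default value of [inf]. *)
Lemma kobayashi_basin p v : basin k d eta p -> kobayashi (basin k d eta) p v = 0.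
Proof.
move=> bp; rewrite /kobayashi; set E := [set _ | _].
have EE (x : R) : 0 < x -> E x by move=> x0; split => //; exact: discs_exist.
have lbE : lbound E 0 by move=> x [/ltW].
apply/eqP; rewrite eq_le; apply/andP; split; last first.
  by apply: lb_le_inf => //; exists 1; exact: EE.
apply/ler_addgt0Pr => e e0; rewrite add0r.
by apply: ge_inf; [exists 0|exact: EE].
Qed.

End Dynamics.

(** * Circle means and Jensen's inequality *)

Section CircleMeans.
Variable R : realType.
Local Notation C := R[i].
Local Notation mu := (@lebesgue_measure R).

Lemma continuous_integrable_itv (f : R -> R) (a b : R) : continuous f ->
  mu.-integrable `[a, b] (EFin \o f).
Proof.
move=> cf; apply: continuous_compact_integrable; first exact: segment_compact.
exact: continuous_subspaceT.
Qed.

(** Change of variable, used for the half-turn [t + pi] and for the doubled angle [2 * t]. *)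
Lemma Rintegral_affine (G : R -> R) (a b c e : R) : a <= b -> 0 < c -> continuous G ->
  \int[mu]_(x in `[c * a + e, c * b + e]) G x =
  c * \int[mu]_(x in `[a, b]) G (c * x + e).
Proof.
move=> ab c0 cG.
pose F x : R := c * x + e.
have dF (x : R) : is_derive x (1 : R) F c.
  have : is_derive x (1 : R) (c *: (id : R -> R) + cst e) (c *: (1 : R) + 0).
    exact: is_deriveD.
  by rewrite addr0 /GRing.scale /= mulr1.
have F'E : F^`() = cst c.
  by apply/funext => x; rewrite derive1E (@derive_val _ _ _ _ _ _ _ (dF x)).
have cF : continuous F.
  move=> x; apply: differentiable_continuous; apply/derivable1_diffP.
  exact: (@ex_derive _ _ _ _ _ _ _ (dF x)).
have cGF : continuous (G \o F) by move=> x; apply: continuous_comp; [exact: cF|exact: cG].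
rewrite -RintegralZl //; last exact: continuous_integrable_itv.
rewrite /Rintegral; congr fine.
rewrite -[c * a + e]/(F a) -[c * b + e]/(F b).
rewrite integration_by_substitution_increasing //.
- by apply: eq_integral => x _; rewrite F'E /= mulrC.
- by move=> x y _ _ xy; rewrite /F ltrD2r ltr_pM2l.
- by rewrite F'E => x _; exact: cvg_cst.
- by rewrite F'E; exact: is_cvg_cst.
- by rewrite F'E; exact: is_cvg_cst.
- split.
  + by move=> x _; exact: (@ex_derive _ _ _ _ _ _ _ (dF x)).
  + exact/cvg_at_right_filter/cF.
  + exact/cvg_at_left_filter/cF.
- exact: continuous_subspaceT.
Qed.

Definition circle (t : R) : C := cos t +i* sin t.

Lemma circle_continuous : continuous circle.
Proof.
by move=> t; apply: continuous_ReIm; [exact: continuous_cos|exact: continuous_sin].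
Qed.

Lemma normc_circle t : normc (circle t) = 1.
Proof. by rewrite /= cos2Dsin2 sqrtr1. Qed.

Lemma circleDpi t : circle (t + pi) = - circle t.
Proof. by rewrite /circle cosDpi sinDpi. Qed.

Lemma circle_double t : circle (2 * t) = circle t ^+ 2.
Proof.
have E : circle t ^+ 2 = (cos t * cos t - sin t * sin t) +i* (cos t * sin t + sin t * cos t).
  by rewrite expr2.
rewrite E /circle mulr_natl cos_mulr2n sin_mulr2n.
have H := cos2Dsin2 t; congr (_ +i* _); last by ring.
by rewrite -!expr2; lra.
Qed.

Definition circle_int (u : R -> R) : R := \int[mu]_(t in @period_itv R) u t.

Lemma pi2_gt0 : 0 < 2 * pi :> R.
Proof. by rewrite mulr_gt0 // pi_gt0. Qed.

Lemma measurable_period_itv : measurable (@period_itv R).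
Proof. exact: measurable_itv. Qed.

Lemma continuous_integrable_period (u : R -> R) : continuous u ->
  mu.-integrable (@period_itv R) (EFin \o u).
Proof. exact: continuous_integrable_itv. Qed.

Lemma circle_int_cst c : circle_int (cst c) = 2 * pi * c.
Proof.
rewrite /circle_int /period_itv Rintegral_cst // mulrC; congr (_ * _).
transitivity (fine (mu (`[0, 2 * pi]%classic : set R))); first by [].
by rewrite lebesgue_measure_itv /= lte_fin pi2_gt0 oppr0 adde0.
Qed.

Lemma circle_int_le (u v : R -> R) : continuous u -> continuous v ->
  (forall t, u t <= v t) -> circle_int u <= circle_int v.
Proof.
move=> cu cv uv; apply: le_Rintegral => [|||t _]; last exact: uv.
- exact: measurable_period_itv.
- exact: continuous_integrable_period.
- exact: continuous_integrable_period.
Qed.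

Lemma circle_intD (u v : R -> R) : continuous u -> continuous v ->
  circle_int (fun t => u t + v t) = circle_int u + circle_int v.
Proof.
move=> cu cv; apply: RintegralD; first exact: measurable_period_itv.
  exact: continuous_integrable_period.
exact: continuous_integrable_period.
Qed.

Lemma circle_intZ (u : R -> R) c : continuous u ->
  circle_int (fun t => c * u t) = c * circle_int u.
Proof.
move=> cu; apply: RintegralZl; first exact: measurable_period_itv.
exact: continuous_integrable_period.
Qed.

(** The second half of the period is moved back by [pi], which pairs each point of the circle with
    its antipode. *)
Lemma circle_int_halves (u : R -> R) : continuous u ->
  circle_int u = \int[mu]_(t in `[0, pi]) (u t + u (t + pi)).
Proof.
move=> cu.
have cS : continuous (fun t => u (t + pi)).
  move=> t; apply: (@continuous_comp _ _ _ (fun t => t + pi) u); last exact: cu.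
  by apply: cvgD; [exact: cvg_id|exact: cvg_cst].
rewrite RintegralD //; try exact: continuous_integrable_itv.
have := @Rintegral_affine u 0 pi 1 pi (pi_ge0 R) ltr01 cu.
rewrite !mul1r add0r => E.
have -> : \int[mu]_(t in `[0, pi]) u (t + pi) = \int[mu]_(x in `[pi, pi + pi]) u x.
  by rewrite E; apply: eq_Rintegral => x _; rewrite mul1r.
have pp : pi <= 2 * pi :> R by have := pi_ge0 R; lra.
have := @Rintegral_itvB R u (BLeft 0) (BRight (2 * pi)) pi
  (continuous_integrable_itv _ _ cu) _ _.
rewrite !bnd_simp pi_ge0 pp => /(_ isT isT).
rewrite Rintegral_itv_obnd_cbnd; last first.
  apply: integrableS (continuous_integrable_itv pi (2 * pi) cu) => //.
  exact: subset_itv_oc_cc.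
move=> /eqP; rewrite subr_eq => /eqP E2.
rewrite /circle_int /period_itv E2 addrC; congr (_ + _); congr (Rintegral _ _ _).
by rewrite -mulr2n mulr_natl.
Qed.

Lemma circle_int_double (u : R -> R) : continuous u ->
  circle_int u = 2 * \int[mu]_(t in `[0, pi]) u (2 * t).
Proof.
move=> cu; have := @Rintegral_affine u 0 pi 2 0 (pi_ge0 R) (ltr0n _ 2) cu.
rewrite mulr0 !addr0 /circle_int /period_itv => ->; congr (_ * _).
by apply: eq_Rintegral => x _; rewrite addr0.
Qed.

(** Dominated convergence with a constant majorant on a set of finite measure. Integrability of the
    limit is recorded because [subharmonic] is stated with an extended-real integral. *)
Lemma circle_int_lim (u_ : (R -> R)^nat) (u : R -> R) (K L : R) :
  (forall n, continuous (u_ n)) ->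
  (forall n t, (@period_itv R) t -> `|u_ n t| <= K) ->
  (forall t, u_ ^~ t @ \oo --> u t) ->
  (forall n, L <= circle_int (u_ n)) ->
  mu.-integrable (@period_itv R) (EFin \o u) /\ L <= circle_int u.
Proof.
move=> cu uK ul HL.
have mD := measurable_period_itv.
have mu_ n : measurable_fun (@period_itv R) (u_ n).
  apply: measurable_funTS; exact: continuous_measurable_fun.
have mu' : measurable_fun (@period_itv R) u.
  by apply: (measurable_fun_cvg mu_) => t _; exact: ul.
have iK : mu.-integrable (@period_itv R) (EFin \o cst K).
  by apply: continuous_integrable_itv => x; exact: cvg_cst.
case: (@dominated_convergence _ _ R mu (@period_itv R) mD
  (fun n => EFin \o u_ n) (EFin \o u) (EFin \o cst K)).
- move=> n; apply/measurable_EFinP; exact: mu_.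
- apply/measurable_EFinP; exact: mu'.
- apply: aeW => t _; apply: cvg_EFin; first by near=> n.
  exact: ul.
- exact: iK.
- by apply: aeW => t n Dt /=; rewrite lee_fin uK.
move=> iu _ cI; split => //.
have fu : (\int[mu]_(t in @period_itv R) (EFin \o u) t)%E = (circle_int u)%:E.
  by rewrite /circle_int /Rintegral fineK //; exact: integrable_fin_num.
have {}cI : (fun n => circle_int (u_ n)) @ \oo --> circle_int u.
  by rewrite fu in cI; exact: fine_cvg cI.
by apply: (cvgr_to_ge cI); near=> n; exact: HL.
Unshelve. all: end_near. Qed.

End CircleMeans.

Lemma ler_norm_bounds (R : realDomainType) (l x b : R) :
  l <= x -> x <= b -> `|x| <= `|l| + `|b|.
Proof.
move=> lx xb; have := ler_norm (- l); have := ler_norm b.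
have := normr_ge0 l; have := normr_ge0 b; rewrite normrN.
by rewrite ler_norml => *; apply/andP; split; lra.
Qed.

(** * Sub-mean value inequality for logarithms of truncated polynomials *)

Section Jensen.
Variable R : realType.
Local Notation C := R[i].

Lemma normc_cvg (T : Type) (F : set_system T) (FF : Filter F) (f : T -> C) (l : C) :
  f @ F --> l -> normc (f x) @[x --> F] --> normc l.
Proof. by move=> fl; apply: (cvg_comp _ _ fl); exact: normc_continuous. Qed.

Lemma normc_factor_continuous (g : C) : continuous (fun t : R => normc (1 - g * circle t)).
Proof.
move=> t; apply: normc_cvg; apply: cvgB; first exact: cvg_cst.
by apply: cvgM; [exact: cvg_cst|exact: circle_continuous].
Qed.

Lemma normc_1subM_le2 (g z : C) : normc g <= 1 -> normc z = 1 -> normc (1 - g * z) <= 2.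
Proof.
move=> g1 z1; apply: le_trans (le_normcD _ _) _.
by rewrite normcN normcM z1 mulr1 normc1; lra.
Qed.

Lemma normc_1subM_ge (g z : C) : normc z = 1 -> 1 - normc g <= normc (1 - g * z).
Proof.
move=> z1; have := le_normcD (1 - g * z) (g * z).
by rewrite subrK normc1 normcM z1 mulr1; lra.
Qed.

Definition ln_factor (g : C) (t : R) : R := ln (normc (1 - g * circle t)).

Lemma normc_factor_gt0 (g : C) t : normc g < 1 -> 0 < normc (1 - g * circle t).
Proof. by move=> g1; have := normc_1subM_ge g (normc_circle t); lra. Qed.

Lemma ln_factor_continuous (g : C) : normc g < 1 -> continuous (ln_factor g).
Proof.
move=> g1 t; apply: (@continuous_comp _ _ _ (fun t => normc (1 - g * circle t)) (@ln R)).
  exact: normc_factor_continuous.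
by apply: continuous_ln; exact: normc_factor_gt0.
Qed.

(** With z on the circle, (1 - g z)(1 + g z) = 1 - g^2 z^2: the sum over two antipodal points for
    [g] is the value at the doubled angle for [g ^+ 2]. *)
Lemma circle_int_ln_factor_sqr (g : C) : normc g < 1 ->
  circle_int (ln_factor (g ^+ 2)) = 2 * circle_int (ln_factor g).
Proof.
move=> g1; have g21 : normc (g ^+ 2) < 1 by rewrite normcX expr_lt1 ?normc_ge0.
rewrite circle_int_double; last exact: ln_factor_continuous.
rewrite (circle_int_halves (ln_factor_continuous g1)); congr (_ * _).
apply: eq_Rintegral => t _; rewrite /ln_factor.
rewrite -lnM ?posrE ?normc_factor_gt0 // -normcM; congr (ln (normc _)).
by rewrite circle_double circleDpi; ring.
Qed.

(* Squaring [g] doubles the mean, while the means stay bounded *)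
Lemma circle_int_ln_factor (g : C) : normc g < 1 -> circle_int (ln_factor g) = 0.
Proof.
move=> g1; set r := normc g; have r0 : 0 <= r by exact: normc_ge0.
pose K := 2 * pi * (ln 2 - ln (1 - r)) : R.
have r1 : 0 < 1 - r by rewrite subr_gt0.
have ln2 : 0 <= ln 2 :> R by apply: ln_ge0; rewrite ler1n.
have lnr : ln (1 - r) <= 0 by apply: ln_le0; rewrite gerBl.
have B n : `|2 ^+ n * circle_int (ln_factor g)| <= K.
  (* The powers stay in the disc of radius [r], so [ln (1 - r)] and [ln 2] bound all the integrands
     uniformly in [n]; [K] comes from integrating these two bounds. *)
  have gn : normc (g ^+ (2 ^ n)) <= r.
    rewrite normcX -[X in _ <= X]expr1; apply: ler_wiXn2l; rewrite ?expn_gt0 //.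
    exact: ltW.
  have gn1 := le_lt_trans gn g1.
  have -> : 2 ^+ n * circle_int (ln_factor g) = circle_int (ln_factor (g ^+ (2 ^ n))).
    elim: n {gn gn1} => [|n IH]; first by rewrite expr0 mul1r expn0 expr1.
    rewrite exprS -mulrA IH -circle_int_ln_factor_sqr; last first.
      by rewrite normcX expr_lt1 ?expn_gt0 ?normc_ge0.
    by rewrite -exprM expnSr.
  have cg := ln_factor_continuous gn1.
  have b1 t : ln_factor (g ^+ (2 ^ n)) t <= ln 2.
    rewrite ler_ln ?posrE ?normc_factor_gt0 //.
    by apply: normc_1subM_le2; [exact: ltW|exact: normc_circle].
  have b2 t : ln (1 - r) <= ln_factor (g ^+ (2 ^ n)) t.
    rewrite ler_ln ?posrE ?normc_factor_gt0 //.
    by apply: le_trans (normc_1subM_ge _ (normc_circle t)); rewrite lerB.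
  have ccst (c : R) : continuous (cst c : R -> R) by move=> x; exact: cvg_cst.
  have := circle_int_le cg (ccst (ln 2)) b1.
  have := circle_int_le (ccst (ln (1 - r))) cg b2.
  rewrite !circle_int_cst => H1 H2; have p0 := pi2_gt0 R.
  rewrite ler_norml /K; apply/andP; split.
    by apply: le_trans H1; rewrite -mulrN ler_pM2l //; lra.
  by apply: le_trans H2 _; rewrite ler_pM2l //; lra.
apply/eqP; case: eqP => // /eqP J0.
have J1 : 0 < `|circle_int (ln_factor g)| by rewrite normr_gt0.
have [n Hn] : exists n, K / `|circle_int (ln_factor g)| < n%:R.
  exists (Num.truncn (K / `|circle_int (ln_factor g)|)).+1; exact: truncnS_gt.
have := B n; rewrite normrM normrX ger0_norm // leNgt -ltr_pdivrMr // => /negP; case.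
apply: (lt_trans Hn); rewrite -natrX ltr_nat; exact: ltn_expl.
Qed.

Implicit Types (gs : seq C).

Definition prod_factor gs (t : R) : R := \prod_(g <- gs) normc (1 - g * circle t).

Lemma prod_factor_continuous gs : continuous (prod_factor gs).
Proof.
apply: continuous_big => [|g _]; first exact: mul_continuous.
exact: normc_factor_continuous.
Qed.

Lemma prod_factor_ge0 gs t : 0 <= prod_factor gs t.
Proof. by apply: prodr_ge0 => g _; exact: normc_ge0. Qed.

Lemma prod_factor_gt0 gs t : (forall g, g \in gs -> normc g < 1) -> 0 < prod_factor gs t.
Proof.
move=> H; rewrite /prod_factor big_seq; apply: prodr_gt0 => g gin.
by apply: normc_factor_gt0; exact: H.
Qed.

Lemma prod_factor_le gs t : (forall g, g \in gs -> normc g <= 1) ->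
  prod_factor gs t <= 2 ^+ size gs.
Proof.
rewrite /prod_factor; elim: gs => [|g gs IH] H; first by rewrite big_nil.
rewrite big_cons exprS; apply: ler_pM; rewrite ?normc_ge0 ?prod_factor_ge0 //.
  by apply: normc_1subM_le2; [apply: H; rewrite mem_head|exact: normc_circle].
by apply: IH => h hin; apply: H; rewrite inE hin orbT.
Qed.

(** The logarithm splits the product into factors of mean zero, leaving [ln A]; continuity is
    carried through the induction because additivity of the integral requires it. *)
Lemma circle_int_ln_prod gs (A : R) : 0 < A -> (forall g, g \in gs -> normc g < 1) ->
  continuous (fun t => ln (A * prod_factor gs t)) /\
  circle_int (fun t => ln (A * prod_factor gs t)) = 2 * pi * ln A.
Proof.
move=> A0; elim: gs => [|g gs IH] H.
  have -> : (fun t => ln (A * prod_factor [::] t)) = cst (ln A).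
    by apply/funext => t; rewrite /prod_factor big_nil mulr1.
  by split; [move=> x; exact: cvg_cst|exact: circle_int_cst].
have [|cI iI] := IH; first by move=> h hin; apply: H; rewrite inE hin orbT.
have g1 : normc g < 1 by apply: H; rewrite mem_head.
have Hgs h : h \in gs -> normc h < 1 by move=> hin; apply: H; rewrite inE hin orbT.
have -> : (fun t => ln (A * prod_factor (g :: gs) t)) =
    (fun t => ln_factor g t + ln (A * prod_factor gs t)).
  apply/funext => t.
  have p1 := normc_factor_gt0 t g1; have p2 := mulr_gt0 A0 (prod_factor_gt0 t Hgs).
  have -> : A * prod_factor (g :: gs) t = normc (1 - g * circle t) * (A * prod_factor gs t).
    by rewrite {1}/prod_factor big_cons mulrCA.
  by rewrite (lnM p1 p2).
have cg := ln_factor_continuous g1.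
split; last by rewrite circle_intD // iI circle_int_ln_factor // add0r.
by move=> t; apply: cvgD; [exact: cg|exact: cI].
Qed.

Lemma ln_max_continuous (c : R) (f : R -> R) : 0 < c -> continuous f ->
  continuous (fun t => ln (Num.max c (f t))).
Proof.
move=> c0 cf t; apply: (@continuous_comp _ _ _ (fun t => Num.max c (f t)) (@ln R)).
  by apply: continuous_max; [exact: cvg_cst|exact: cf].
by apply: continuous_ln; rewrite lt_max c0.
Qed.

Lemma circle_int_ge_cst (c : R) (f : R -> R) : continuous f -> (forall t, c <= f t) ->
  2 * pi * c <= circle_int f.
Proof.
move=> cf H; rewrite -circle_int_cst; apply: circle_int_le => // x; exact: cvg_cst.
Qed.

(** A factor with |g| = 1 may vanish on the circle. The parameters are shrunk to [s n * g], where
    the mean is exactly [ln A], and [n] tends to infinity; the floor [c] keeps the logarithms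
    bounded below. *)
Lemma ln_max_prod_submean gs (c A : R) : 0 < c -> 0 <= A ->
  (forall g, g \in gs -> normc g <= 1) ->
  2 * pi * ln (Num.max c A) <=
    circle_int (fun t => ln (Num.max c (A * prod_factor gs t))).
Proof.
move=> c0 A0 Hgs.
have cA hs : continuous (fun t => A * prod_factor hs t).
  by move=> t; apply: cvgM; [exact: cvg_cst|exact: prod_factor_continuous].
case: (leP A c) => [Ac|cltA].
  apply: circle_int_ge_cst => [|t]; first exact: ln_max_continuous.
  by rewrite ler_ln ?posrE ?lt_max ?c0 // le_max lexx.
have Agt0 := lt_trans c0 cltA.
pose s (n : nat) : R := 1 - n.+1%:R^-1.
have s01 n : 0 <= s n < 1.
  rewrite subr_ge0 invf_le1 ?ltr0n // ler1n /=.
  by rewrite gtrBl invr_gt0 ltr0n.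
pose hs n := [seq (s n)%:C * g | g <- gs].
have Hhs n h : h \in hs n -> normc h < 1.
  case/mapP => g gin ->; rewrite normcM normc_re.
  have /andP[s0 s1] := s01 n; rewrite ger0_norm //.
  by have := Hgs g gin; have := normc_ge0 g; nra.
(* Majorant for dominated convergence: each factor is at most 2, so the logarithms lie between the
   two values occurring here. *)
pose M := `|ln c| + `|ln (Num.max c (A * 2 ^+ size gs))|.
apply: (proj2 (@circle_int_lim R
  (fun n t => ln (Num.max c (A * prod_factor (hs n) t))) _ M _ _ _ _ _)).
- by move=> n; exact: ln_max_continuous.
- move=> n t _; set x := Num.max c _.
  have x0 : c <= x by rewrite le_max lexx.
  have H1 : ln c <= ln x by rewrite ler_ln ?posrE // (lt_le_trans c0).
  have H2 : ln x <= ln (Num.max c (A * 2 ^+ size gs)).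
    rewrite ler_ln ?posrE ?lt_max ?c0 //.
    rewrite ge_max le_max lexx /= le_max ler_pM2l //.
    by rewrite -(size_map (fun g => (s n)%:C * g) gs) prod_factor_le ?orbT // => h /Hhs/ltW.
  exact: ler_norm_bounds.
- move=> t; apply: continuous_cvg; first by apply: continuous_ln; rewrite lt_max c0.
  apply: (@continuous_cvg _ _ _ _ _ (fun n => A * prod_factor (hs n) t) (fun y => Num.max c y)).
    by apply: continuous_max; [exact: cvg_cst|exact: cvg_id].
  apply: cvgM; first exact: cvg_cst.
  have -> : (fun n => prod_factor (hs n) t) = (fun n => \prod_(g <- gs) normc (1 - (s n)%:C * g * circle t)).
    by apply/funext => n; rewrite /prod_factor /hs big_map.
  apply: cvg_big => [|g _]; first exact: mul_continuous.
  apply: normc_cvg; apply: cvgB; first exact: cvg_cst.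
  apply: cvgM; last exact: cvg_cst.
  rewrite -[X in _ --> X]mul1r; apply: cvgM; last exact: cvg_cst.
  apply: cvg_complexP.
  have -> : (fun n => normc (1 - (s n)%:C)) = (fun n => n.+1%:R^-1).
    apply/funext => n; have -> : 1 - (s n)%:C = (1 - s n)%:C.
      by apply/eqP; rewrite eq_complex /= subr0 !eqxx.
    rewrite normc_re.
    by rewrite /s opprB addrC subrK ger0_norm // invr_ge0.
  exact: cvg_harmonic.
- move=> n; have [cI <-] := circle_int_ln_prod Agt0 (Hhs n).
  apply: circle_int_le => // [|t]; first exact: ln_max_continuous.
  have P0 := prod_factor_gt0 t (Hhs n).
  by rewrite ler_ln ?posrE ?lt_max ?c0 ?mulr_gt0 // le_max lexx orbT.
Qed.

Lemma normc_conj (z : C) : normc (conjc z) = normc z.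
Proof. by case: z => x y /=; rewrite sqrrN. Qed.

(** If |b| <= r, then |r z - b| = |r - conj(b) z| for |z| = 1, and r factors out; otherwise b
    factors out. So A = max(r, |b|), which dominates the modulus |b| at the centre. *)
Lemma linear_factor_on_circle (b : C) (r : R) : 0 < r ->
  exists (A : R) (g : C), [/\ 0 <= A, normc g <= 1, normc b <= A &
    forall z, normc z = 1 -> normc (r%:C * z - b) = A * normc (1 - g * z)].
Proof.
move=> r0; have rC : r%:C != 0 by rewrite (inj_eq (@complexI R)) gt_eqF.
have nr : normc r%:C = r by rewrite normc_re ger0_norm // ltW.
case: (leP (normc b) r) => br.
  exists r, (conjc (b / r%:C)); split => //; first exact: ltW.
    by rewrite normc_conj normcM normcV nr ler_pdivrMr // mul1r.
  move=> z z1.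
  have zz : z * conjc z = 1.
    by rewrite -sqr_normc -[`|z|]/((normc z)%:C) z1 expr1n.
  have -> : r%:C * z - b = z * (r%:C - b * conjc z).
    by rewrite mulrBr mulrCA zz mulr1 mulrC.
  rewrite normcM z1 mul1r -normc_conj rmorphB rmorphM /= conjcK.
  have -> : conjc r%:C - conjc b * z = r%:C * (1 - conjc (b / r%:C) * z).
    have -> : conjc (b / r%:C) = conjc b / r%:C.
      have -> : (r%:C)^-1 = (r^-1)%:C by rewrite fmorphV.
      have -> : conjc b * (r^-1)%:C = conjc b * conjc (r^-1)%:C by rewrite conjc_real.
      exact: rmorphM.
    by rewrite conjc_real; field.
  by rewrite normcM nr.
have b0 : b != 0.
  by apply: contraTneq br => ->; rewrite normc0 -leNgt ltW.
exists (normc b), (r%:C / b); split; rewrite ?normc_ge0 //.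
  by rewrite normcM normcV nr ler_pdivrMr ?normc_gt0 // mul1r ltW.
move=> z _; rewrite -normcM -normcN opprB; congr normc.
by field.
Qed.

(** [P] splits over [C], and each root [x] contributes the linear factor with [b = x - z0]; the
    constants multiply, as do the bounds at the centre. *)
Lemma poly_on_circle (P : {poly C}) (z0 : C) (r : R) : 0 < r ->
  exists (A : R) gs, [/\ 0 <= A, (forall g, g \in gs -> normc g <= 1), normc P.[z0] <= A &
    forall t, normc P.[z0 + r%:C * circle t] = A * prod_factor gs t].
Proof.
move=> r0; have [rs ->] := closed_field_poly_normal P.
set l := lead_coef P; elim: rs => [|x rs [A [gs [A0 Hgs HA Ht]]]].
  exists (normc l), [::]; rewrite big_nil; split => //; first exact: normc_ge0.
    by rewrite hornerZ hornerC mulr1.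
  by move=> t; rewrite hornerZ hornerC mulr1 /prod_factor big_nil mulr1.
have [B [g [B0 g1 HB Hz]]] := linear_factor_on_circle (x - z0) r0.
have E y : (l *: \prod_(z <- x :: rs) ('X - z%:P)).[y] =
    (y - x) * (l *: \prod_(z <- rs) ('X - z%:P)).[y].
  by rewrite big_cons !hornerZ hornerM hornerXsubC mulrCA.
exists (B * A), (g :: gs); split.
- exact: mulr_ge0.
- by move=> h; rewrite inE => /orP[/eqP -> //|]; exact: Hgs.
- rewrite E normcM; apply: ler_pM; rewrite ?normc_ge0 //.
  by rewrite -normcN opprB.
move=> t; rewrite E normcM Ht /prod_factor big_cons.
have -> : z0 + r%:C * circle t - x = r%:C * circle t - (x - z0) by ring.
by rewrite Hz ?normc_circle //; ring.
Qed.

Lemma ln_max_poly_submean (P : {poly C}) (c r : R) (z0 : C) : 0 < c -> 0 < r ->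
  2 * pi * ln (Num.max c (normc P.[z0])) <=
  circle_int (fun t => ln (Num.max c (normc P.[z0 + r%:C * circle t]))).
Proof.
move=> c0 r0; have [A [gs [A0 Hgs HA Ht]]] := poly_on_circle P z0 r0.
under eq_fun do rewrite Ht.
apply: le_trans (ln_max_prod_submean c0 A0 Hgs).
rewrite ler_pM2l ?pi2_gt0 // ler_ln ?posrE ?lt_max ?c0 //.
by rewrite ge_max !le_max lexx HA orbT.
Qed.

Lemma cvg_expC (T : Type) (F : set_system T) (FF : Filter F) (f : T -> C) (l : C) n :
  f @ F --> l -> (fun x => f x ^+ n) @ F --> l ^+ n.
Proof.
move=> fl; elim: n => [|n IH]; first exact: cvg_cst.
have -> : (fun x => f x ^+ n.+1) = (fun x => f x * f x ^+ n).
  by apply/funext => x; rewrite exprS.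
rewrite [l ^+ n.+1]exprS.
exact: (@cvgM _ _ F FF f (fun x => f x ^+ n) _ _ fl IH).
Qed.

Lemma normc_poly_circle_continuous (P : {poly C}) (z0 : C) (r : R) :
  continuous (fun t => normc P.[z0 + r%:C * circle t]).
Proof.
have -> : (fun t => normc P.[z0 + r%:C * circle t]) =
    (fun t => normc (\sum_(i < size P) P`_i * (z0 + r%:C * circle t) ^+ i)).
  by apply/funext => t; rewrite horner_coef.
move=> t; apply: normc_cvg; apply: cvg_big => [|i _]; first exact: add_continuous.
apply: cvgM; first exact: cvg_cst.
have cz : z0 + r%:C * circle x @[x --> t] --> z0 + r%:C * circle t.
  apply: cvgD; first exact: cvg_cst.
  by apply: cvgM; [exact: cvg_cst|exact: circle_continuous].
exact: cvg_expC.
Qed.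

Lemma bigmax_continuous (T : topologicalType) (I : finType) (c : R) (f : I -> T -> R) :
  (forall i, continuous (f i)) -> continuous (fun t => \big[Num.max/c]_i f i t).
Proof.
move=> cf; apply: continuous_big => [|i _]; last exact: cf.
move=> p; apply: continuous_max; [exact: cvg_fst|exact: cvg_snd].
Qed.

Lemma bigmax_cases (I : finType) (c : R) (f : I -> R) :
  \big[Num.max/c]_i f i = c \/ exists i, \big[Num.max/c]_i f i = Num.max c (f i).
Proof.
apply: (big_rec (fun x => x = c \/ exists i, x = Num.max c (f i))); first by left.
move=> i x _ [->|[j ->]]; first by right; exists i; rewrite maxC.
right; case: (leP (f i) (Num.max c (f j))) => h; first by exists j.
exists i; apply/esym/max_r; apply: le_trans (ltW h); by rewrite le_max lexx.
Qed.

(** At the centre the maximum is [c] or involves a single polynomial, to which the previous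
    inequality applies; the other polynomials can only increase the circle mean. *)
Lemma ln_max_polys_submean (I : finType) (P : I -> {poly C}) (c r : R) (z0 : C) :
  0 < c -> 0 < r ->
  2 * pi * ln (\big[Num.max/c]_i normc (P i).[z0]) <=
  circle_int (fun t => ln (\big[Num.max/c]_i normc (P i).[z0 + r%:C * circle t])).
Proof.
move=> c0 r0.
have cle (f : I -> R) : c <= \big[Num.max/c]_i f i by exact: bigmax_ge_id.
have cM : continuous (fun t => ln (\big[Num.max/c]_i normc (P i).[z0 + r%:C * circle t])).
  move=> t; apply: (@continuous_comp _ _ _ (fun t => \big[Num.max/c]_i normc (P i).[z0 + r%:C * circle t]) (@ln R)).
    by apply: bigmax_continuous => i; exact: normc_poly_circle_continuous.
  by apply: continuous_ln; exact: lt_le_trans (cle _).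
have [->|[i ->]] := bigmax_cases c (fun i => normc (P i).[z0]).
  apply: circle_int_ge_cst => // t.
  by rewrite ler_ln ?posrE // (lt_le_trans c0).
apply: le_trans (ln_max_poly_submean _ _ c0 r0) _.
apply: circle_int_le => // [|t].
  by apply: ln_max_continuous => //; exact: normc_poly_circle_continuous.
have pos (x : R) : c <= x -> 0 < x by exact: lt_le_trans.
rewrite ler_ln ?posrE ?pos ?le_max ?lexx //.
by rewrite ge_max cle /=; exact: (le_bigmax _ (fun i => normc (P i).[z0 + r%:C * circle t])).
Qed.

End Jensen.

(** * The plurisubharmonic function *)

(** If the infimum at [x] is below [c], some [h n x] already is, and continuity of that one [h n]
    keeps it so nearby. *)
Lemma usc_inf (R : realType) (T : topologicalType) (h : nat -> T -> R) :
  (forall n, continuous (h n)) ->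
  (forall x, has_lbound (range (h ^~ x))) ->
  usc (fun x => inf (range (h ^~ x))).
Proof.
move=> ch hb x c /= /inf_lt.
have h0 : range (h ^~ x) !=set0 by exists (h 0%N x), 0%N.
move=> /(_ h0) [_ [n _ <-] hc].
have : \forall y \near x, h n y < c by apply: (cvgr_lt (h n x)) => //; exact: ch.
apply: filterS => y; apply: le_lt_trans.
by apply: ge_inf => //; exists n.
Qed.

Section Exhaustion.
Variables (R : realType) (k d : nat) (a : R) (eta : nat -> R[i]).
Local Notation C := R[i].
Local Notation coord := Defs.coord.
Hypothesis k_gt1 : (1 < k)%N.
Hypothesis d_gt1 : (1 < d)%N.
Hypothesis a01 : 0 < a < 1.
Hypothesis eta_le : forall n, normc (eta n) <= a ^+ (d ^ n).
Implicit Types (z w : 'rV[C]_k).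
Local Notation F := (@Fcomp R k d eta).

Lemma a_gt0 : 0 < a. Proof. by case/andP: a01. Qed.

Lemma a_pow_gt0 n : 0 < a ^+ n. Proof. by rewrite exprn_gt0 // a_gt0. Qed.

Lemma a_dexp_le n : a ^+ (d ^ n) <= a ^+ n.
Proof.
have /andP[a0 a1] := a01.
by rewrite ler_wiXn2l ?(ltW a0) ?(ltW a1) // ltnW // ltn_expl.
Qed.

Lemma a_dexp_cvg0 : (fun n => a ^+ (d ^ n)) @ \oo --> (0 : R).
Proof.
have /andP[a0 a1] := a01.
have H : (fun n => a ^+ n) @ \oo --> (0 : R) by apply: cvg_expr; rewrite ger0_norm ?ltW.
apply: (squeeze_cvgr _ (cvg_cst 0) H); near=> n.
by rewrite (ltW (a_pow_gt0 _)) a_dexp_le.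
Unshelve. all: end_near. Qed.

Lemma eta_cvg0 : (fun n => normc (eta n)) @ \oo --> (0 : R).
Proof.
apply: (squeeze_cvgr _ (cvg_cst 0) a_dexp_cvg0); near=> n.
by rewrite normc_ge0 eta_le.
Unshelve. all: end_near. Qed.

(** Restriction to a complex line reduces plurisubharmonicity to the circle means of polynomials in
    one variable. *)
Lemma coord_poly n z w j : exists P : {poly C}, forall l, coord (F n (z + l *: w)) j = P.[l].
Proof.
have step (G : C -> 'rV[C]_k) e : (forall j, exists P : {poly C}, forall l, coord (G l) j = P.[l]) ->
    forall j, exists P : {poly C}, forall l, coord (Fmap d e (G l)) j = P.[l].
  move=> /choice [P HP] {}j.
  case: (coord_cases R k j) => [[i H]|H]; last first.
    by exists 0 => l; rewrite H horner0.
  case: (boolP (i == 0 :> nat)) => i0.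
    by exists (e *: P k.-1) => l; rewrite H mxE i0 hornerZ HP.
  exists (P i ^+ d + e *: P i.-1) => l.
  by rewrite H mxE (negPf i0) hornerD hornerZ horner_exp !HP.
elim: n j => [|n IH]; apply: step; last exact: IH.
move=> j; exists ((coord z j)%:P + (coord w j) *: 'X) => l.
rewrite hornerD hornerC hornerZ hornerX.
by case: (coord_cases R k j) => [[i H]|H]; rewrite !H ?mxE ?mul0r ?addr0 // mulrC.
Qed.

(** The floor keeps the logarithm finite and becomes the lower bound [ln a] after division by
    [d ^ n]. *)
Definition supnorm n z : R := \big[Num.max/a ^+ (d ^ n)]_(i < k) normc (F n z ord0 i).

Lemma supnorm_ge n z : a ^+ (d ^ n) <= supnorm n z.
Proof. exact: bigmax_ge_id. Qed.

Lemma supnorm_gt0 n z : 0 < supnorm n z.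
Proof. exact: lt_le_trans (a_pow_gt0 _) (supnorm_ge n z). Qed.

Lemma normc_le_supnorm n z i : normc (F n z ord0 i) <= supnorm n z.
Proof. exact: (le_bigmax _ (fun i => normc (F n z ord0 i))). Qed.

Lemma normc_coord_le_supnorm n z j : normc (coord (F n z) j) <= supnorm n z.
Proof.
case: (coord_cases R k j) => [[i H]|H]; rewrite H ?normc0; last exact/ltW/supnorm_gt0.
exact: normc_le_supnorm.
Qed.

Lemma supnorm_step n z : supnorm n.+1 z <= 2 * supnorm n z ^+ d.
Proof.
set M := supnorm n z; have M0 : 0 < M by exact: supnorm_gt0.
have Md0 : 0 < M ^+ d by exact: exprn_gt0.
have aM : a ^+ (d ^ n.+1) <= M ^+ d.
  rewrite expnSr exprM; apply: lerXn2r; rewrite ?nnegrE ?(ltW M0) ?(ltW (a_pow_gt0 _)) //.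
  exact: supnorm_ge.
have a1 : a ^+ (d ^ n.+1) <= 1 by have /andP[a0 a1] := a01; rewrite exprn_ile1 ?ltW.
(* For M <= 1 the product is at most a^(d^(n+1)), which the floor puts below M^d; for M > 1 it is at
   most M <= M^d. *)
have eM : normc (eta n.+1) * M <= M ^+ d.
  apply: (@le_trans _ _ (a ^+ (d ^ n.+1) * M)); first by rewrite ler_pM2r.
  have [M1|/ltW M1] := leP M 1.
    by apply: le_trans aM; rewrite ler_piMr // ltW // a_pow_gt0.
  apply: (@le_trans _ _ M); first by rewrite ler_piMl // ltW.
  by rewrite -[X in X <= _]expr1; apply: ler_weXn2l => //; exact: ltnW.
have ec j : normc (eta n.+1 * coord (F n z) j) <= M ^+ d.
  rewrite normcM; apply: le_trans eM; apply: ler_wpM2l; first exact: normc_ge0.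
  exact: normc_coord_le_supnorm.
apply: bigmax_le => [|i _]; first by lra.
rewrite /= mxE; case: eqP => _; first by apply: le_trans (ec _) _; lra.
apply: le_trans (le_normcD _ _) _; rewrite normcX.
have : normc (coord (F n z) i) ^+ d <= M ^+ d.
  apply: lerXn2r; rewrite ?nnegrE ?normc_ge0 ?(ltW M0) //.
  exact: normc_coord_le_supnorm.
by have := ec i.-1; lra.
Qed.

(* The constant absorbs the factor 2 of [supnorm_step]: [(d - 1) * drift = ln 2] *)
Definition drift : R := ln 2 / d.-1%:R.

Definition psi n z : R := (d ^ n)%:R^-1 * (ln (supnorm n z) + drift).

Lemma predd_gt0 : 0 < d.-1%:R :> R.
Proof. by rewrite ltr0n; lia. Qed.

Lemma ln2_gt0 : 0 < ln 2 :> R.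
Proof. by apply: ln_gt0; rewrite ltr1n. Qed.

Lemma drift_ge0 : 0 <= drift.
Proof. by rewrite divr_ge0 // ?(ltW ln2_gt0) // ltW // predd_gt0. Qed.

Lemma drift_le : drift <= ln 2.
Proof.
rewrite ler_pdivrMr ?predd_gt0 // ler_peMr ?(ltW ln2_gt0) //.
by rewrite ler1n; lia.
Qed.

Lemma dexp_gt0 n : 0 < (d ^ n)%:R :> R.
Proof. by rewrite ltr0n expn_gt0 (ltnW d_gt1). Qed.

(** Taking logarithms in [supnorm_step] leaves an excess [ln 2], absorbed by the identity
    [ln 2 + drift = d * drift]. *)
Lemma psi_decr n z : psi n.+1 z <= psi n z.
Proof.
have H : ln (supnorm n.+1 z) <= ln 2 + d%:R * ln (supnorm n z).
  rewrite mulr_natl -lnXn ?supnorm_gt0 // -lnM ?posrE ?exprn_gt0 ?supnorm_gt0 //.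
  by rewrite ler_ln ?posrE ?mulr_gt0 ?exprn_gt0 ?supnorm_gt0 // supnorm_step.
have dd : d%:R = d.-1%:R + 1 :> R by rewrite natr1 prednK // ltnW.
have D : ln 2 + drift = d%:R * drift.
  have : drift * d.-1%:R = ln 2 by rewrite /drift divfK // gt_eqF // predd_gt0.
  by rewrite dd => <-; ring.
have d0 : 0 < d%:R :> R by rewrite ltr0n ltnW.
rewrite /psi expnS natrM invfM -mulrA mulrCA ler_pM2l ?invr_gt0 ?dexp_gt0 //.
by rewrite ler_pdivrMl //; lra.
Qed.

Lemma psi_mono n m z : (n <= m)%N -> psi m z <= psi n z.
Proof.
elim: m => [|m IH]; first by rewrite leqn0 => /eqP ->.
rewrite leq_eqVlt => /orP[/eqP -> //|]; rewrite ltnS => /IH.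
exact/le_trans/psi_decr.
Qed.

Lemma psi_ge n z : ln a <= psi n z.
Proof.
rewrite /psi ler_pdivlMl ?dexp_gt0 //.
have : ln (a ^+ (d ^ n)) <= ln (supnorm n z).
  by rewrite ler_ln ?posrE ?a_pow_gt0 ?supnorm_gt0 // supnorm_ge.
by rewrite lnXn ?a_gt0 // mulr_natl; have := drift_ge0; lra.
Qed.

Lemma psi_continuous n : continuous (psi n).
Proof.
have cS : continuous (supnorm n).
  apply: bigmax_continuous => i z.
  apply: (@continuous_comp _ _ _ (fun z => F n z ord0 i : C) (@normc R)); last exact: normc_continuous.
  apply: (@continuous_comp _ _ _ (F n) (fun z : 'rV[C]_k => z ord0 i : C)).
    by apply: Fcomp_continuous.
  exact: row_coord_continuous.
move=> z; apply: (@continuous_comp _ _ _ (supnorm n) (fun x => (d ^ n)%:R^-1 * (ln x + drift))).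
  exact: cS.
apply: cvgM; first exact: cvg_cst.
apply: cvgD; last exact: cvg_cst.
by apply: continuous_ln; exact: supnorm_gt0.
Qed.

(** The infimum form gives upper semicontinuity at once; as [psi] decreases in [n] it is also the
    limit ([psi_cvg]), the form used under the integral. *)
Definition phi z : R := inf (range (psi ^~ z)).

Lemma psi_lbound z : has_lbound (range (psi ^~ z)).
Proof. by exists (ln a) => _ [n _ <-]; exact: psi_ge. Qed.

Lemma phi_le n z : phi z <= psi n z.
Proof. by apply: ge_inf; [exact: psi_lbound|exists n]. Qed.

Lemma phi_ge z : ln a <= phi z.
Proof.
apply: lb_le_inf; first by exists (psi 0 z), 0%N.
by move=> _ [n _ <-]; exact: psi_ge.
Qed.

Lemma psi_cvg z : psi ^~ z @ \oo --> phi z.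
Proof.
apply: nonincreasing_cvgn; last exact: psi_lbound.
by move=> n m; exact: psi_mono.
Qed.

Lemma line_continuous z w : continuous (fun l : C => z + l *: w).
Proof.
move=> l; apply: differentiable_continuous; apply: differentiableD; first exact: differentiable_cst.
by apply: (@differentiableZl _ _ _ (fun l : C => l)).
Qed.

Lemma psi_line_continuous n z w (z0 : C) (r : R) :
  continuous (fun t => psi n (z + (z0 + r%:C * circle t) *: w)).
Proof.
move=> t.
apply: (@continuous_comp _ _ _ (fun t => z0 + r%:C * circle t) (fun l : C => psi n (z + l *: w))).
  apply: cvgD; first exact: cvg_cst.
  by apply: cvgM; [exact: cvg_cst|exact: circle_continuous].
apply: (@continuous_comp _ _ _ (fun l : C => z + l *: w) (psi n)); first exact: line_continuous.
exact: psi_continuous.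
Qed.

Lemma psi_submean n z w (z0 : C) (r : R) : 0 < r ->
  2 * pi * psi n (z + z0 *: w) <=
  circle_int (fun t => psi n (z + (z0 + r%:C * circle t) *: w)).
Proof.
move=> r0.
have /choice [P HP] : forall i : 'I_k, exists P : {poly C}, forall l, F n (z + l *: w) ord0 i = P.[l].
  move=> i; have [P HP] := coord_poly n z w i; exists P => l.
  by rewrite -HP coord_ord.
pose u l := ln (\big[Num.max/a ^+ (d ^ n)]_(i < k) normc (P i).[l]).
have psiE l : psi n (z + l *: w) = (d ^ n)%:R^-1 * (u l + drift).
  by rewrite /psi /supnorm /u; under eq_bigr do rewrite HP.
(* Continuity of [u] is inherited from [psi n] by inverting the affine relation [psiE]. *)
have cu : continuous (fun t => u (z0 + r%:C * circle t)).
  have -> : (fun t => u (z0 + r%:C * circle t)) =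
      (fun t => (d ^ n)%:R * psi n (z + (z0 + r%:C * circle t) *: w) - drift).
    by apply/funext => t; rewrite psiE mulVKf ?gt_eqF ?dexp_gt0 // addrK.
  move=> t; apply: cvgB; last exact: cvg_cst.
  by apply: cvgM; [exact: cvg_cst|exact: psi_line_continuous].
have cc : continuous (cst drift : R -> R) by move=> x; exact: cvg_cst.
have -> : (fun t => psi n (z + (z0 + r%:C * circle t) *: w)) =
    (fun t => (d ^ n)%:R^-1 * (u (z0 + r%:C * circle t) + cst drift t)).
  by apply/funext => t; rewrite psiE.
rewrite circle_intZ; last by move=> t; apply: cvgD; [exact: cu|exact: cc].
rewrite circle_intD // circle_int_cst psiE mulrCA ler_pM2l ?invr_gt0 ?dexp_gt0 //.
rewrite mulrDr lerD2r.
exact: (ln_max_polys_submean P z0 (a_pow_gt0 _) r0).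
Qed.

Lemma phi_subharmonic z w : subharmonic (fun l : C => phi (z + l *: w)).
Proof.
split.
  apply: (@usc_inf R C (fun n l => psi n (z + l *: w))) => [n l|l]; last exact: psi_lbound.
  apply: (@continuous_comp _ _ _ (fun l : C => z + l *: w) (psi n)); first exact: line_continuous.
  exact: psi_continuous.
(* The inequality holds for every positive radius, so the bound 1 is arbitrary. *)
move=> z0; exists 1 => // r /andP[r0 _].
pose u_ n t := psi n (z + (z0 + r%:C * circle t) *: w).
pose u t := phi (z + (z0 + r%:C * circle t) *: w).
have cu n : continuous (u_ n) by exact: psi_line_continuous.
(* By monotonicity in [n], the maximum of [u_ 0] over the period bounds every [u_ n] from above;
   [ln a] bounds them from below. *)
have [t0 _ Ht0] := EVT_max (ltW (pi2_gt0 R)) (continuous_subspaceT (cu 0%N)).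
have uK n t : (@period_itv R) t -> `|u_ n t| <= `|ln a| + `|u_ 0%N t0|.
  move=> /Ht0 H; apply: ler_norm_bounds; first exact: psi_ge.
  exact: le_trans (psi_mono _ (leq0n n)) H.
have ul t : u_ ^~ t @ \oo --> u t by exact: psi_cvg.
have Lu_ n : 2 * pi * phi (z + z0 *: w) <= circle_int (u_ n).
  apply: le_trans (psi_submean n z w z0 r0).
  by apply: ler_wpM2l; [exact/ltW/pi2_gt0|exact: phi_le].
have [iu Lu] := circle_int_lim cu uK ul Lu_.
have -> : (\int[lebesgue_measure]_(t in @period_itv R)
    (phi (z + (z0 + r%:C * (cos t +i* sin t)) *: w))%:E)%E = (circle_int u)%:E.
  rewrite /circle_int /Rintegral fineK //.
  by apply: integrable_fin_num iu; exact: measurable_period_itv.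
by rewrite -EFinM lee_fin ler_pdivlMl ?pi2_gt0.
Qed.

Lemma phi_psh : psh phi.
Proof.
split; last exact: phi_subharmonic.
by apply: usc_inf => [n|z]; [exact: psi_continuous|exact: psi_lbound].
Qed.

Lemma sqnorm_le_supnorm n z : sqnorm (F n z) <= k%:R * supnorm n z ^+ 2.
Proof.
have B (i : 'I_k) : normc (F n z ord0 i) ^+ 2 <= supnorm n z ^+ 2.
  apply: lerXn2r; rewrite ?nnegrE ?normc_ge0 ?(ltW (supnorm_gt0 _ _)) //.
  exact: normc_le_supnorm.
apply: le_trans (ler_sum _ (fun i _ => B i)) _.
by rewrite sumr_const card_ord mulr_natl.
Qed.

(** Some [psi m z] is negative; for n >= m, ln M_n <= d^n * [psi m z] <= n * [psi m z], so the orbit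
    decays at least geometrically with ratio [expR (psi m z)]. *)
Lemma phi_lt0_basin z : phi z < 0 -> basin k d eta z.
Proof.
move=> p0; apply/basin_sqnorm.
have [m Hm] : exists m, psi m z < 0.
  have h0 : range (psi ^~ z) !=set0 by exists (psi 0 z), 0%N.
  by have [_ [m _ <-] h] := inf_lt h0 p0; exists m.
set q := expR (psi m z).
have q0 : 0 <= q by exact: expR_ge0.
have q1 : q < 1 by rewrite expR_lt1.
have B n : (m <= n)%N -> supnorm n z <= q ^+ n.
  move=> mn; rewrite -[X in X <= _]lnK ?posrE ?supnorm_gt0 //.
  rewrite /q -expRM_natl ler_expR.
  have := psi_mono z mn; rewrite {1}/psi ler_pdivrMl ?dexp_gt0 //.
  have := drift_ge0; have : (d ^ n)%:R * psi m z <= n%:R * psi m z.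
    by rewrite ler_wnM2r ?(ltW Hm) // ler_nat ltnW // ltn_expl.
  by lra.
have H : (fun n => k%:R * (q ^+ n * q ^+ n)) @ \oo --> (0 : R).
  have qc : (fun n => q ^+ n) @ \oo --> (0 : R) by apply: cvg_expr; rewrite ger0_norm.
  rewrite -[X in _ --> X](mulr0 (k%:R : R)); apply: cvgM; first exact: cvg_cst.
  by rewrite -[X in _ --> X](mulr0 (0 : R)); exact: cvgM.
apply: (squeeze_cvgr _ (cvg_cst 0) H); near=> n.
rewrite sqnorm_ge0 /=; apply: le_trans (sqnorm_le_supnorm _ _) _.
have mn : (m <= n)%N by near: n; exists m.
rewrite ler_wpM2l // -expr2; apply: lerXn2r; rewrite ?nnegrE ?exprn_ge0 ?(ltW (supnorm_gt0 _ _)) //.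
exact: B.
Unshelve. all: end_near. Qed.

Lemma basin_phi_lt0 z : basin k d eta z -> phi z < 0.
Proof.
move=> /basin_sqnorm Hz.
(* The threshold 1/4 makes [ln (supnorm n z)] at most [- 2 * ln 2]; as [drift <= ln 2], [psi n z] is
   then negative. *)
have [n [Hn Ha]] : exists n, sqnorm (F n z) < 4^-1 ^+ 2 /\ a ^+ (d ^ n) < 4^-1.
  have e1 : 0 < 4^-1 ^+ 2 :> R by rewrite exprn_gt0.
  have e2 : 0 < 4^-1 :> R by [].
  move/cvgrPdist_lt : Hz => /(_ _ e1) H1; move/cvgrPdist_lt : a_dexp_cvg0 => /(_ _ e2) H2.
  near \oo => n; exists n; split.
    have : `|0 - sqnorm (F n z)| < 4^-1 ^+ 2 by near: n; exact: H1.
    by rewrite sub0r normrN ger0_norm ?sqnorm_ge0.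
  have : `|0 - a ^+ (d ^ n)| < 4^-1 by near: n; exact: H2.
  by rewrite sub0r normrN ger0_norm // ltW // a_pow_gt0.
have M4 : supnorm n z <= 4^-1.
  apply: bigmax_le => [|i _]; first exact: ltW.
  rewrite -(ler_pXn2r (n := 2)) ?nnegrE ?normc_ge0 //.
  by apply: ltW; apply: le_lt_trans Hn; exact: normc_le_sqnorm.
apply: le_lt_trans (phi_le n z) _.
rewrite /psi pmulr_rlt0 ?invr_gt0 ?dexp_gt0 //.
have l4 : ln (supnorm n z) <= - ln 2 - ln 2.
  apply: (@le_trans _ _ (ln 4^-1)); first by rewrite ler_ln ?posrE ?supnorm_gt0.
  rewrite lnV ?posrE // (_ : 4 = 2 * 2) ?lnM ?posrE //; last by ring.
  by rewrite opprD.
by have := drift_le; have := ln2_gt0; lra.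
Unshelve. all: end_near. Qed.

Lemma basin_phi : basin k d eta = [set z | phi z < 0].
Proof.
by apply/seteqP; split => z; [exact: basin_phi_lt0|exact: phi_lt0_basin].
Qed.

End Exhaustion.

Unset Implicit Arguments.
Theorem theorem3p1 (R : realType) (k d : nat) (a : R) (eta : nat -> R[i]) :
  (2 <= k)%N -> 0 < a < 1 -> (2 <= d)%N ->
  (forall n, eta n != 0) ->
  (forall n, `|eta n| <= (a ^+ (d ^ n)%N)%:C) ->
  [/\ (basin k d eta !=set0 /\ open (basin k d eta) /\ connected (basin k d eta)),
      (exists Om : nat -> set 'rV[R[i]]_k,
         [/\ basin k d eta = \bigcup_j Om j,
             (forall j, Om j `<=` Om j.+1) &
             (forall j, open (Om j) /\ biholomorphic (Om j) (unit_ball k))]),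
      (forall p v : 'rV[R[i]]_k, basin k d eta p -> kobayashi (basin k d eta) p v = 0) &
      (exists phi : 'rV[R[i]]_k -> R,
         [/\ psh phi, (forall z, ln a <= phi z) &
             basin k d eta = [set z | phi z < 0]])].
Proof.
move=> k2 a01 d2 eta0 eta_leC.
(* The modulus in the hypothesis is an element of [R[i]]; the bound is brought down to [R]. *)
have eta_le n : normc (eta n) <= a ^+ (d ^ n) by rewrite -lecR; exact: eta_leC.
have e0 := eta_cvg0 d2 a01 eta_le.
have [N HN] := eta_small k2 e0.
split.
- split; first by exists 0; exact: (basin0 k2 d2 HN).
  by split; [exact: (basin_open k2 d2 HN)|exact: (basin_connected k2 d2 eta0 HN)].
- exists (trap d eta N); split.
  + exact: (basin_trap k2 d2 HN).
  + exact: (trap_sub k2 d2 HN).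
  + by move=> j; split; [exact: trap_open|by apply: trap_biholomorphic].
- by move=> p v; exact: kobayashi_basin.
- exists (phi d a eta); split; [exact: phi_psh|exact: phi_ge|exact: basin_phi].
Qed.
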